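(* Let $d\ge 1$ be an integer, $a>0$, $\lambda>0$ and $0<\epsilon<a/4$. Let $\omega$ be a Poisson point process on the torus $\mathbb{T}_a^d$ with intensity measure $\lambda\,dx$, and for an integer $k\ge 1$ let $N_k$ be the number of $(k-1)$-simplices of the Čech complex $\mathcal{C}_\epsilon(\omega)$. Then for all integers $1\le l\le k$, $$\operatorname{Cov}[N_k,N_l]=\sum_{i=1}^{l}\frac{\lambda a^d\bigl(\lambda(2\epsilon)^d\bigr)^{k+l-i-1}}{i!\,(k-i)!\,(l-i)!}\left(k+l-i+2\,\frac{(k-i)(l-i)}{i+1}\right)^d.$$
   Context: $\mathbb{T}_a^d=\mathbb{R}^d/a\mathbb{Z}^d$, identified with $X=[0,a)^d$, is equipped with Lebesgue measure and the distance $\rho_d(x,y)=\inf_{m\in\mathbb{Z}^d}\|x-y+ma\|_\infty$. For a finite set $\omega\subset\mathbb{T}_a^d$, the Čech complex $\mathcal{C}_\epsilon(\omega)$ is the abstract simplicial complex with vertex set $\omega$ in which distinct points $v_0,\dots,v_k\in\omega$ form a $k$-simplex if and only if $\bigcap_{i=0}^k B(v_i,\epsilon)\neq\emptyset$, where $B(v,\epsilon)=\{y:\rho_d(v,y)<\epsilon\}$. A Poisson point process with intensity measure $\lambda\,dx$ is a random finite set $\omega$ such that the number of points in any Borel set $A$ is Poisson with mean $\lambda|A|$, with independence over disjoint sets. *)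

(* Defs.v *)
From HB Require Import structures.
From mathcomp Require Import all_boot all_order all_algebra finmap.
From mathcomp Require Import all_classical all_reals all_analysis.
From mathcomp Require Import measurable_realfun.

Set Implicit Arguments.
Unset Strict Implicit.
Unset Printing Implicit Defensive.

Import Order.TTheory GRing.Theory Num.Theory.
Import numFieldNormedType.Exports.

Local Open Scope classical_set_scope.
Local Open Scope fset_scope.
Local Open Scope ring_scope.

(* On ['rV[R]_d], [open] refers to the topology of the sup norm [`|x|], which is
   the library's norm on row vectors. *)
Definition borel (R : realType) (d : nat) (A : set 'rV[R]_d) : Prop :=
  <<s [set U : set 'rV[R]_d | open U] >> A.

(* d-dimensional Lebesgue measure of a Borel set, as the d-fold product of
   one-dimensional Lebesgue measure: the measure of the sections is integrated
   over the first coordinate, and R^0 carries the unit mass. *)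
Fixpoint lebesgue_rV (R : realType) (d : nat) : set 'rV[R]_d -> \bar R :=
  match d return set 'rV[R]_d -> \bar R with
  | 0 => fun A => (\1_A 0)%:E
  | d'.+1 => fun A =>
      (\int[@lebesgue_measure R]_x
         lebesgue_rV [set t : 'rV[R]_d' | A (row_mx x%:M t)])%E
  end.

Lemma lebesgue_rV0 (R : realType) (d : nat) :
  lebesgue_rV (@set0 'rV[R]_d) = 0%E.
Proof.
elim: d => [|d IH] /=; first by rewrite indic0.
by rewrite (eq_integral (cst 0%E)) ?integral0// => x _; exact: IH.
Qed.

Lemma lebesgue_rV_box (R : realType) (d : nat) (l u : 'rV[R]_d) :
  (forall i, l 0 i <= u 0 i) ->
  lebesgue_rV [set x : 'rV[R]_d | forall i, l 0 i <= x 0 i < u 0 i] =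
  (\prod_i (u 0 i - l 0 i))%:E.
Proof.
elim: d l u => [|d IH] l u lu /=.
  by rewrite big_ord0 indicE mem_set// => -[].
pose l' : 'rV[R]_d := \row_i l 0 (rshift 1 i).
pose u' : 'rV[R]_d := \row_i u 0 (rshift 1 i).
have lu' i : l' 0 i <= u' 0 i by rewrite !mxE.
set c : R := \prod_i (u' 0 i - l' 0 i).
pose i0 : 'I_(1 + d) := lshift d ord0.
have E x : lebesgue_rV [set t : 'rV[R]_d | forall i : 'I_(1 + d),
    l 0 i <= row_mx x%:M t 0 i < u 0 i] =
    (c%:E * (\1_(`[l 0 i0, u 0 i0[%classic) x)%:E)%E.
  rewrite indicE; have [xI|xI] := boolP (x \in `[l 0 i0, u 0 i0[).
    rewrite mem_set//= mule1 -IH//; congr lebesgue_rV.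
    apply/seteqP; split => t /= H i.
      by have := H (rshift 1 i); rewrite row_mxEr !mxE.
    have [j ->|j ->] := split_ordP i; last by have := H j; rewrite row_mxEr !mxE.
    by rewrite ord1 row_mxEl mxE mulr1n; move: xI; rewrite in_itv.
  rewrite memNset/= ?mule0; last exact/negP.
  have -> : [set t : 'rV[R]_d | forall i : 'I_(1 + d),
      l 0 i <= row_mx x%:M t 0 i < u 0 i] = set0.
    rewrite -subset0 => t /= /(_ i0); rewrite row_mxEl mxE mulr1n => H.
    by move/negP: xI; apply; rewrite in_itv.
  exact: lebesgue_rV0.
under eq_integral do rewrite E.
have c0 : (0 <= c%:E)%E by rewrite lee_fin prodr_ge0// => i _; rewrite subr_ge0.
rewrite ge0_integralZl//; last exact/measurable_EFinP/measurable_indic.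
rewrite integral_indic// setIT.
rewrite [X in (_ * X)%E](lebesgue_measure_itv `[l 0 i0, u 0 i0[)/= lte_fin.
rewrite big_ord_recl (_ : ord0 = i0); last exact/val_inj.
have -> : \prod_(i < d) (u 0 (lift ord0 i) - l 0 (lift ord0 i)) = c.
  apply: eq_bigr => i _; rewrite !mxE.
  by rewrite (_ : lift ord0 i = rshift 1 i)//; exact/val_inj.
case: ltP => [_|ul]; first by rewrite -EFinD -EFinM mulrC.
have -> : u 0 i0 = l 0 i0 by apply/le_anti; rewrite ul lu.
by rewrite subrr mul0r mule0.
Qed.

(* The torus R^d/aZ^d, identified with its fundamental domain [0,a)^d. *)
Definition torus (R : realType) (d : nat) (a : R) : set 'rV[R]_d :=
  [set x | forall i, 0 <= x 0 i < a].

Definition torus_dist (R : realType) (d : nat) (a : R) (x y : 'rV[R]_d) : R :=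
  inf [set `|x - y + a *: map_mx intr m| | m in [set: 'rV[int]_d]].

Definition torus_ball (R : realType) (d : nat) (a : R) (v : 'rV[R]_d)
    (r : R) : set 'rV[R]_d :=
  [set y | torus a y /\ torus_dist a v y < r].

(* An abstract simplicial complex is represented by the set of its (nonempty)
   simplices. *)
Definition cech_complex (R : realType) (d : nat) (a eps : R)
    (omega : {fset 'rV[R]_d}) : {fset {fset 'rV[R]_d}} :=
  [fset s in fpowerset omega | (s != fset0) &&
     `[< \bigcap_(v in [set` s]) torus_ball a v eps !=set0 >]].

(* A [j]-simplex has [j.+1] vertices. *)
Definition num_simplices (V : choiceType) (j : nat) (K : {fset {fset V}}) : nat :=
  #|` [fset s in K | #|` s| == j.+1]|.

Definition independent (dO : measure_display) (Omega : measurableType dO)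
    (R : realType) (P : probability Omega R) (I : finType)
    (dT : measure_display) (T : measurableType dT) (X : I -> Omega -> T) : Prop :=
  forall J : {set I}, forall B : I -> set T, (forall i, measurable (B i)) ->
    P (\bigcap_(i in [set` J]) (X i @^-1` B i)) =
    (\prod_(i in J) P (X i @^-1` B i))%E.

Definition count_in (R : realType) (d : nat) (A : set 'rV[R]_d)
    (omega : {fset 'rV[R]_d}) : nat :=
  #|` [fset x in omega | x \in A]|.

(* The second argument of [poisson_prob] is not used by its definition;
   [poisson_prob 0 _] is the Dirac mass at 0. *)
Definition poisson_point_process (dO : measure_display)
    (Omega : measurableType dO) (R : realType) (P : probability Omega R)
    (d : nat) (a lambda : R) (omega : Omega -> {fset 'rV[R]_d}) : Prop :=
  [/\ forall w x, x \in omega w -> torus a x,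
      forall A, borel A -> (A `<=` torus a)%classic ->
        measurable_fun [set: Omega] (fun w => count_in A (omega w)),
      forall A, borel A -> (A `<=` torus a)%classic ->
        forall U : set nat, P [set w | U (count_in A (omega w))] =
          poisson_prob (lambda * fine (lebesgue_rV A)) 0%N U
    & forall (n : nat) (A : 'I_n -> set 'rV[R]_d),
        (forall i, borel (A i) /\ (A i `<=` torus a)%classic) ->
        trivIset [set: 'I_n] A ->
        independent P (fun i w => count_in (A i) (omega w))].

(* Main.v *)
(* The torus is cut into [s.+1 ^ d] cubic cells. A set of cells is good if, in
   each coordinate, it fits in a cyclic arc whose length is just below
   [2 * eps]; points lying in a good set of cells then span a simplex and, for a
   given finite configuration, the converse holds once [s] is large. So the
   number of good [k]-sets of occupied cells is at most [N_k] and eventually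
   equal to it, and by Fatou and dominated convergence the covariance of [N_k]
   and [N_l] is the limit of the discrete ones.
   Cells are occupied independently with probability [p = 1 - exp (- mu)], where
   [mu = lambda * (a / s.+1) ^ d], so the discrete covariance is the sum over [i >= 1] of
   [p ^ (k + l - i) * (1 - p ^ i)] times the number of pairs of good sets
   [(S, T)] sharing exactly [i] cells. Up to non-injective tuples, which are
   negligible, this number is the [d]-th power of its one-dimensional analogue.
   The latter has a closed form, because a nonempty set fits in an arc of length
   [m] iff the number of arcs of length [m] containing it exceeds by one the
   number of arcs of length [m - 1] containing it. *)
Require Import Defs.
From mathcomp Require Import all_boot all_order all_algebra finmap zify ring lra.

Set Implicit Arguments.
Unset Strict Implicit.
Unset Printing Implicit Defensive.

Import Order.TTheory GRing.Theory Num.Theory.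

Local Open Scope ring_scope.

(** * Arcs of a discrete circle *)

(* The subtraction is the cyclic one of ['I_s.+1]. *)
Definition arc (s : nat) (w : 'I_s.+1) (m : nat) : {set 'I_s.+1} :=
  [set c : 'I_s.+1 | (val (c - w)%R < m)%N]%SET.

Definition fits (s m : nat) (S : {set 'I_s.+1}) : bool :=
  [exists w, S \subset arc w m].

Lemma val_sub_ord (s : nat) (c w : 'I_s.+1) (t : nat) :
  (t < s.+1)%N -> val c = w + t %[mod s.+1] -> val (c - w)%R = t.
Proof.
move=> ts cwt.
have -> : c = w + inZp t.
  by apply: val_inj; rewrite /= modnDmr -cwt modn_small ?ltn_ord.
by rewrite addrC addKr /= modn_small.
Qed.

Lemma ord_sub_eqmod (s : nat) (c w : 'I_s.+1) :
  val c = w + val (c - w)%R %[mod s.+1].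
Proof.
by have /(congr1 val) /= := addrNK w c; rewrite addnC => {1}<-; rewrite modn_mod.
Qed.

Lemma card_arc (s m : nat) (w : 'I_s.+1) :
  (m <= s.+1)%N -> #|arc w m| = m.
Proof.
move=> ms; have f_inj : injective (fun t : 'I_m => widen_ord ms t + w)%R.
  by move=> x y /addIr [xy]; exact/val_inj.
rewrite -[RHS]card_ord -(card_codom f_inj); apply: eq_card => c.
apply/idP/codomP => [|[x ->]]; last by rewrite inE addrK /=.
rewrite inE => cm; exists (Ordinal cm); rewrite -[LHS](subrK w).
by congr (_ + _); exact/val_inj.
Qed.

Lemma arcS (s m : nat) (w : 'I_s.+1) :
  (m < s.+1)%N -> arc w m.+1 = (w |: arc (w + inZp 1) m)%SET.
Proof.
move=> ms; apply/setP => c; rewrite !inE opprD addrA.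
have [->|cw] := eqVneq c w; first by rewrite subrr.
move: cw; rewrite -subr_eq0; set u := c - w => u0.
have u_gt0 : (0 < u)%N by rewrite lt0n; apply: contra u0 => /eqP u0; apply/eqP/val_inj.
case: s ms w c @u u0 u_gt0 => [|s] ms w c u u0 u_gt0.
  by have := ltn_ord u; lia.
have -> : val (u - inZp 1)%R = (val u).-1.
  apply: val_sub_ord; first exact: leq_ltn_trans (leq_pred _) (ltn_ord u).
  rewrite [val (inZp 1)]/= modnDml add1n prednK//.
by rewrite -[val u]/(nat_of_ord u) orFb -{1}(prednK u_gt0).
Qed.

(** Otherwise [arc w m.+1] would coincide with [arc (w + inZp 1) m] and have only [m] points. *)
Lemma notin_arcS (s m : nat) (w : 'I_s.+1) :
  (m < s.+1)%N -> w \notin arc (w + inZp 1) m.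
Proof.
move=> ms; apply/negP => wm.
have := card_arc w (ms : m.+1 <= s.+1)%N; rewrite arcS//.
have /setUidPr -> : ([set w] \subset arc (w + inZp 1) m)%SET by rewrite sub1set.
by rewrite card_arc 1?ltnW// => /n_Sn.
Qed.

(* If [S] fits in an arc of length [m], exactly one of those containing it starts
   at a point of [S]; the others, with their first point removed, are the arcs of length
   [m.-1] containing [S]. *)
Lemma fits_card_arcs (s m : nat) (S : {set 'I_s.+1}) :
  S != set0%SET -> (m.*2 <= s.+1)%N ->
  (\sum_(w : 'I_s.+1) (S \subset arc w m) =
   fits m S + \sum_(w : 'I_s.+1) (S \subset arc w m.-1))%N.
Proof.
move=> S0; case: m => [|m] ms /=.
  suff -> : fits 0 S = false by [].
  apply: negbTE; apply/existsPn => w; apply/negP => /subsetP Sw.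
  by case/set0Pn: S0 => x /Sw; rewrite inE.
have ms' : (m < s.+1)%N by lia.
(* An arc starting outside [S] contains [S] iff it still does without its first point; an arc
   starting in [S] no longer does. *)
have shift w : (S \subset arc w m.+1 =
    (w \in S) && (S \subset arc w m.+1) + (S \subset arc (w + inZp 1)%R m) :> nat)%N.
  have [wS|wS] /= := boolP (w \in S).
    suff -> : (S \subset arc (w + inZp 1) m) = false by rewrite addn0.
    by apply/negP => /subsetP/(_ _ wS); rewrite (negPf (notin_arcS _ _)).
  rewrite add0n; congr nat_of_bool; rewrite arcS//.
  apply/subsetP/subsetP => H x xS; have := H _ xS; rewrite !inE.
    by case/predU1P => // xw; rewrite -xw xS in wS.
  by move=> ->; rewrite orbT.
under eq_bigr do rewrite shift.
rewrite big_split/=; congr addn; last first.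
  by rewrite [RHS](reindex_inj (addIr (inZp 1))).
have [/existsP[w0 Sw0]|/existsPn nfit] := boolP (fits m.+1 S); last first.
  by rewrite big1// => w _; rewrite (negPf (nfit w)) andbF.
have [x xS] := set0Pn _ S0.
(* The point of [S] met first when travelling from [w0], so that the rest of [S] lies ahead of it
   within the same arc. *)
pose w := [arg min_(c < x in S) val (c - w0)%R].
have [wS wmin] : w \in S /\ forall c, c \in S -> (val (w - w0)%R <= val (c - w0)%R)%N.
  by rewrite /w; case: arg_minnP.
have Sw : S \subset arc w m.+1.
  apply/subsetP => c cS; rewrite inE.
  have := wmin _ cS; have := subsetP Sw0 _ cS; rewrite inE => h1 h2.
  rewrite (@val_sub_ord _ _ _ (val (c - w0)%R - val (w - w0)%R)%N); first lia.
    by have := ltn_ord (c - w0); lia.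
  by rewrite -modnDml (ord_sub_eqmod w w0) modnDml -addnA subnKC// -ord_sub_eqmod.
rewrite (bigD1 w)//= wS Sw big1 ?addn0// => w' w'w.
have [/andP[w'S Sw']|] := boolP (_ && _) => //.
have := subsetP Sw _ w'S; have := subsetP Sw' _ wS; rewrite !inE => h1 h2.
case/eqP: w'w; apply/eqP; rewrite -subr_eq0; apply/eqP/val_inj => /=.
(* Two such starting points are at most [m] steps apart in both directions. The two differences add
   up to a multiple of [s.+1] below [m.+1.*2], hence to zero. *)
have : (val (w - w')%R + val (w' - w)%R = 0 %[mod s.+1])%N.
  by have /(congr1 val) := subrr (w - w'); rewrite opprB /= mod0n.
rewrite mod0n modn_small; first by move/eqP; rewrite addn_eq0 => /andP[_ /eqP].
by move: h1 h2 ms => /=; lia.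
Qed.

(** * Pairs of arcs and maps with images in both *)

Lemma sub_arc (s m n : nat) (w : 'I_s.+1) :
  (m <= n)%N -> arc w m \subset arc w n.
Proof. by move=> mn; apply/subsetP => c; rewrite !inE => /leq_trans; apply. Qed.

(** The values of [f] are constrained independently: to [X :&: Y] on [A :&: B], to [X] on [A :\: B],
    and to [Y] on [B :\: A]. *)
Lemma sum_sub_imset2 (J T : finType) (A B : {set J}) (X Y : {set T}) :
  (A :|: B = [set: J])%SET ->
  (\sum_(f : {ffun J -> T}) (f @: A \subset X) * (f @: B \subset Y) =
   #|X :&: Y| ^ #|A :&: B| * #|X| ^ #|A :\: B| * #|Y| ^ #|B :\: A|)%N.
Proof.
move=> AB.
pose F j : {set T} := if j \in A then if j \in B then X :&: Y else X else Y.
transitivity #|family (fun j : J => mem (F j))|.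
  rewrite -sum1_card [RHS]big_mkcond; apply: eq_bigr => f _.
  rewrite mulnb; suff -> : (f \in family (fun j => mem (F j))) =
    (f @: A \subset X) && (f @: B \subset Y) by case: (_ && _).
  apply/familyP/andP => [fF|[/subsetP fA /subsetP fB] j].
    split; apply/subsetP => _ /imsetP[j jC ->].
      have : f j \in F j := fF j; rewrite /F jC.
      by case: ifP; rewrite ?inE// => _ /andP[].
    have : f j \in F j := fF j; rewrite /F jC.
    by case: ifP; rewrite ?inE// => _ /andP[].
  change (f j \in F j); have := in_setT j; rewrite -AB inE /F; case: ifPn => jA /=.
    have fX : f j \in X by apply/fA/imset_f.
    by case: ifPn => jB _; rewrite ?inE fX//=; apply/fB/imset_f.
  by move=> jB; apply/fB/imset_f.
rewrite card_family foldrE big_map big_enum/=.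
rewrite (bigID (mem A))/= (bigID (mem B))/=; congr (_ * _ * _)%N.
- rewrite (eq_bigr (fun=> #|X :&: Y|)) => [|j /andP[jA jB]]; last by rewrite /F jA jB.
  rewrite prod_nat_const; congr (_ ^ _)%N; apply: eq_card => j.
  by rewrite !inE.
- rewrite (eq_bigr (fun=> #|X|)) => [|j /andP[jA jB]]; last by rewrite /F jA (negPf jB).
  rewrite prod_nat_const; congr (_ ^ _)%N; apply: eq_card => j.
  by rewrite !inE andbC.
- rewrite (eq_bigr (fun=> #|Y|)) => [|j jA]; last by rewrite /F (negPf jA).
  rewrite prod_nat_const; congr (_ ^ _)%N; apply: eq_card => j.
  have := in_setT j; rewrite -AB !inE [in LHS]unfold_in.
  by case: (j \in A) => //= ->.
Qed.

(** The number of triples formed by an [i]-tuple of points and two arcs, of lengths [x] and [y],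
    both containing it. *)
Definition overlap (s i x y : nat) : nat :=
  (\sum_(w : 'I_s.+1) \sum_(w' : 'I_s.+1) #|arc w x :&: arc w' y| ^ i)%N.

Lemma overlapC (s i x y : nat) : overlap s i x y = overlap s i y x.
Proof.
rewrite /overlap exchange_big/=; apply: eq_bigr => w _; apply: eq_bigr => w' _.
by rewrite setIC.
Qed.

(** For a fixed arc of length [x] and a tuple in it, [fits_card_arcs] compares the arcs of lengths
    [m] and [m.-1] around the tuple. Since [x <= m] the tuple fits in length [m], so the excess is
    one for each of the [s.+1 * x ^ i] choices. *)
Lemma overlap_rec (s i x m : nat) :
  (0 < i)%N -> (m.*2 <= s.+1)%N -> (x <= m)%N ->
  (overlap s i x m = s.+1 * x ^ i + overlap s i x m.-1)%N.
Proof.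
move=> i0 ms xm.
have ovE y : overlap s i x y = (\sum_(w : 'I_s.+1) \sum_(f : {ffun 'I_i -> 'I_s.+1})
    (f @: [set: 'I_i] \subset arc w x) *
    \sum_(w' : 'I_s.+1) (f @: [set: 'I_i] \subset arc w' y))%N.
  apply: eq_bigr => w _; under [RHS]eq_bigr do rewrite big_distrr/=.
  rewrite exchange_big/=; apply: eq_bigr => w' _.
  rewrite sum_sub_imset2 ?setUid// setIid setDv cards0 !expn0 !muln1.
  by rewrite cardsT card_ord.
rewrite !ovE -[X in (X * _)%N](card_ord s.+1) -sum_nat_const -big_split/=.
apply: eq_bigr => w _.
have -> : (x ^ i = \sum_(f : {ffun 'I_i -> 'I_s.+1})
    (f @: [set: 'I_i] \subset arc w x))%N.
  have := @sum_sub_imset2 'I_i 'I_s.+1 setT setT (arc w x) (arc w x) (setUid _).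
  rewrite !setIid setDv cards0 !expn0 !muln1 cardsT card_ord card_arc; last lia.
  by move=> <-; apply: eq_bigr => f _; rewrite mulnb andbb.
rewrite -big_split/=; apply: eq_bigr => f _.
rewrite fits_card_arcs//; last first.
  by apply/set0Pn; exists (f (Ordinal i0)); apply/imset_f.
rewrite mulnDr; congr addn; rewrite mulnb; congr nat_of_bool.
have [fx|//] := boolP (_ \subset arc w x).
by apply/existsP; exists w; apply: subset_trans fx (sub_arc _ xm).
Qed.

(** Lowering the two lengths in turn by [overlap_rec] adds [m.+1 ^ i] and then [m ^ i], which
    telescopes. *)
Lemma overlap_diag (s i m : nat) :
  (0 < i)%N -> (m.*2 <= s.+1)%N ->
  (overlap s i m m = s.+1 * (m ^ i + 2 * \sum_(t < m) t ^ i))%N.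
Proof.
move=> i0; elim: m => [|m IH] ms.
  rewrite big_ord0 exp0n// !muln0 /overlap; apply: big1 => w _; apply: big1 => w' _.
  suff -> : arc w 0 = set0 by rewrite set0I cards0 exp0n.
  by apply/setP => c; rewrite !inE.
rewrite overlap_rec// overlapC overlap_rec//= IH; last by lia.
by rewrite big_ord_recr/=; lia.
Qed.

Lemma overlap_pred (s i m : nat) :
  (0 < i)%N -> (m.*2 <= s.+1)%N ->
  (overlap s i m m.-1 = s.+1 * (2 * \sum_(t < m) t ^ i))%N.
Proof.
move=> i0 ms; apply/eqP; rewrite -(eqn_add2l (s.+1 * m ^ i)).
by rewrite -overlap_rec// overlap_diag// mulnDr.
Qed.

(** By [fits_card_arcs] each [fits] is a difference of numbers of arcs of lengths [m] and [m.-1], so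
    the sum is a mixed second difference of [H]. For fixed arcs the entries in only one of the
    tuples are free, which makes [H x y] equal to [x ^ p * y ^ q * overlap s i x y]. *)
Lemma sum_fits2 (R : comNzRingType) (s m : nat) (J : finType) (A B : {set J}) :
  (A :|: B = [set: J])%SET -> (A :&: B != set0)%SET -> (m.*2 <= s.+1)%N ->
  let i := #|A :&: B| in let p := #|A :\: B| in let q := #|B :\: A| in
  (\sum_(f : {ffun J -> 'I_s.+1}) fits m (f @: A) * fits m (f @: B))%N%:R =
  s.+1%:R * (m%:R ^+ (i + p + q) - m.-1%:R ^+ (i + p + q) +
    2 * (\sum_(t < m) t ^ i)%N%:R * (m%:R ^+ p - m.-1%:R ^+ p) *
      (m%:R ^+ q - m.-1%:R ^+ q)) :> R.
Proof.
move=> AB AB0 ms i p q.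
have i0 : (0 < i)%N by rewrite card_gt0.
have im0 (C : {set J}) (f : {ffun J -> 'I_s.+1}) :
    A :&: B \subset C -> f @: C != set0.
  case/set0Pn: AB0 => j jAB /subsetP/(_ _ jAB) jC.
  by apply/set0Pn; exists (f j); apply/imset_f.
pose H x y : R := \sum_(f : {ffun J -> 'I_s.+1})
  (\sum_(w : 'I_s.+1) (f @: A \subset arc w x))%N%:R *
  (\sum_(w : 'I_s.+1) (f @: B \subset arc w y))%N%:R.
have HE x y : (x <= s.+1)%N -> (y <= s.+1)%N ->
    H x y = (x ^ p * y ^ q * overlap s i x y)%N%:R.
  move=> xs ys; rewrite /H; under eq_bigr do rewrite -natrM.
  rewrite -natr_sum; congr _%:R.
  under eq_bigr => f _ do (rewrite big_distrl/=; under eq_bigr do rewrite big_distrr/=).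
  rewrite exchange_big big_distrr/=; apply: eq_bigr => w _.
  rewrite exchange_big big_distrr/=; apply: eq_bigr => w' _.
  by rewrite sum_sub_imset2// !card_arc// -mulnA mulnC.
transitivity (H m m - H m m.-1 - H m.-1 m + H m.-1 m.-1).
  rewrite natr_sum -!sumrB -big_split/=; apply: eq_bigr => f _.
  rewrite !(fits_card_arcs (im0 _ _ _) ms) ?subsetIl ?subsetIr//.
  by rewrite natrM !natrD; ring.
rewrite !HE; try lia.
(* Derived from [overlap_rec] instead of [overlap_diag], so that the formula also holds when
   [m = 0]. *)
have ov : (overlap s i m.-1 m.-1)%:R =
    s.+1%:R * (2 * (\sum_(t < m) t ^ i)%N%:R - m.-1%:R ^+ i) :> R.
  have := @overlap_rec s i m.-1 m i0 ms (leq_pred m).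
  rewrite overlapC overlap_pred// => /(congr1 (fun n => n%:R : R)).
  by rewrite natrD !natrM natrX => E; rewrite mulrBr E addrAC subrr add0r.
rewrite !natrM ov (overlapC _ _ m.-1 m) overlap_diag// overlap_pred//.
rewrite !natrM natrD natrM !natrX !exprD.
by ring.
Qed.

(** * Tuples and pairs of good sets of cells *)

Definition good (d s m : nat) (S : {set {ffun 'I_d -> 'I_s.+1}}) : bool :=
  [forall j : 'I_d, fits m [set (c : {ffun 'I_d -> 'I_s.+1}) j | c in S]%SET].

(* Index type of the pairs of tuples sharing [i] entries: the first tuple is
   indexed by ['I_i + 'I_p], the second one by ['I_i + 'I_q]. *)
Definition tupleA (i p q : nat) : {set 'I_i + 'I_p + 'I_q} :=
  [set x | if x is inl _ then true else false]%SET.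

Definition tupleB (i p q : nat) : {set 'I_i + 'I_p + 'I_q} :=
  [set x | if x is inl (inr _) then false else true]%SET.

Lemma tupleABU (i p q : nat) : (tupleA i p q :|: tupleB i p q = setT)%SET.
Proof. by apply/setP => -[[]|] x; rewrite !inE. Qed.

Lemma card_tupleABI (i p q : nat) : #|(tupleA i p q :&: tupleB i p q)%SET| = i.
Proof.
have inj : injective (fun x : 'I_i => inl (inl x) : 'I_i + 'I_p + 'I_q) by move=> ? ? [].
rewrite -[RHS]card_ord -(card_codom inj); apply: eq_card => -[[]|] x.
- by rewrite !inE codom_f.
- by rewrite !inE/=; apply/esym/negbTE/codomP => -[].
- by rewrite !inE/=; apply/esym/negbTE/codomP => -[].
Qed.

Lemma card_tupleAB (i p q : nat) : #|(tupleA i p q :\: tupleB i p q)%SET| = p.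
Proof.
have inj : injective (fun x : 'I_p => inl (inr x) : 'I_i + 'I_p + 'I_q) by move=> ? ? [].
rewrite -[RHS]card_ord -(card_codom inj); apply: eq_card => -[[]|] x.
- by rewrite !inE/=; apply/esym/negbTE/codomP => -[].
- by rewrite !inE/= codom_f.
- by rewrite !inE/=; apply/esym/negbTE/codomP => -[].
Qed.

Lemma card_tupleBA (i p q : nat) : #|(tupleB i p q :\: tupleA i p q)%SET| = q.
Proof.
have inj : injective (fun x : 'I_q => inr x : 'I_i + 'I_p + 'I_q) by move=> ? ? [].
rewrite -[RHS]card_ord -(card_codom inj); apply: eq_card => -[[]|] x.
- by rewrite !inE/=; apply/esym/negbTE/codomP => -[].
- by rewrite !inE/=; apply/esym/negbTE/codomP => -[].
- by rewrite !inE/= codom_f.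
Qed.

Lemma card_tupleA (i p q : nat) : #|tupleA i p q| = (i + p)%N.
Proof. by rewrite -(cardsID (tupleB i p q)) card_tupleABI card_tupleAB. Qed.

Lemma card_tupleB (i p q : nat) : #|tupleB i p q| = (i + q)%N.
Proof. by rewrite -(cardsID (tupleA i p q)) setIC card_tupleABI card_tupleBA. Qed.

Definition pairs_meeting (T : finType) (Q : pred {set T}) (i k l : nat) :
    {set {set T} * {set T}} :=
  [set U | [&& Q U.1, Q U.2, #|U.1| == k, #|U.2| == l & #|U.1 :&: U.2| == i]]%SET.

(** Such an [f] amounts to three bijections, onto [S :&: S'], [S :\: S'] and [S' :\: S]. *)
Lemma card_injective_images (T : finType) (i p q : nat) (S S' : {set T}) :
  #|S| = (i + p)%N -> #|S'| = (i + q)%N -> #|S :&: S'| = i ->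
  #|[set f : {ffun 'I_i + 'I_p + 'I_q -> T} |
      [&& injectiveb f, f @: tupleA i p q == S & f @: tupleB i p q == S']]%SET| =
  (i`! * p`! * q`!)%N.
Proof.
move=> cS cS' cI.
pose inj n (X : {set T}) : {set {ffun 'I_n -> T}} :=
  [set g in ffun_on (mem X) | injectiveb g]%SET.
have card_inj n (X : {set T}) : #|X| = n -> #|inj n X| = n`!.
  by move=> <-; rewrite /inj card_inj_ffuns_on card_ord ffactnn.
have cSS' : #|S :\: S'| = p by apply/eqP; rewrite -(eqn_add2l i) -{1}cI cardsID cS.
have cS'S : #|S' :\: S| = q.
  by apply/eqP; rewrite -(eqn_add2l i) -{1}cI setIC cardsID cS'.
pose phi (f : {ffun 'I_i + 'I_p + 'I_q -> T}) :=
  ([ffun x => f (inl (inl x))], [ffun x => f (inl (inr x))], [ffun x => f (inr x)]).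
have phi_inj : injective phi.
  move=> f g [/ffunP e1 /ffunP e2 /ffunP e3]; apply/ffunP => -[[]|] x.
  - by have := e1 x; rewrite !ffunE.
  - by have := e2 x; rewrite !ffunE.
  - by have := e3 x; rewrite !ffunE.
rewrite -(card_inj _ _ cI) -(card_inj _ _ cSS') -(card_inj _ _ cS'S).
rewrite -!cardsX -(card_imset _ phi_inj).
apply: eq_card => -[[g1 g2] g3]; rewrite [RHS]inE [X in X && _]inE/=.
apply/imsetP/idP => [[f]|].
  rewrite inE => /and3P[/injectiveP fI /eqP fA /eqP fB] [-> -> ->].
  have inS x : (f x \in S) = (x \in tupleA i p q) by rewrite -fA mem_imset.
  have inS' x : (f x \in S') = (x \in tupleB i p q) by rewrite -fB mem_imset.
  rewrite !inE; apply/andP; split; [apply/andP; split|]; apply/andP; split.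
  - by apply/ffun_onP => x; rewrite ffunE !inE inS inS' !inE.
  - by apply/injectiveP => x y; rewrite !ffunE => /fI[].
  - by apply/ffun_onP => x; rewrite ffunE !inE inS inS' !inE.
  - by apply/injectiveP => x y; rewrite !ffunE => /fI[].
  - by apply/ffun_onP => x; rewrite ffunE !inE inS inS' !inE.
  - by apply/injectiveP => x y; rewrite !ffunE => /fI[].
rewrite !inE => /andP[/andP[/andP[/ffun_onP h1 /injectiveP i1]
  /andP[/ffun_onP h2 /injectiveP i2]] /andP[/ffun_onP h3 /injectiveP i3]].
have {}h1 x : (g1 x \in S) && (g1 x \in S') by have := h1 x; rewrite !inE.
have {}h2 x : (g2 x \notin S') && (g2 x \in S) by have := h2 x; rewrite !inE.
have {}h3 x : (g3 x \notin S) && (g3 x \in S') by have := h3 x; rewrite !inE.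
pose f : {ffun 'I_i + 'I_p + 'I_q -> T} := [ffun x : 'I_i + 'I_p + 'I_q =>
  match x with inl (inl y) => g1 y | inl (inr y) => g2 y | inr y => g3 y end].
have fI : injective f.
  move=> [[]|] x [[]|] y; rewrite !ffunE => e.
  - by rewrite (i1 _ _ e).
  - by have := h1 x; have := h2 y; rewrite e; do !case: (_ \in _).
  - by have := h1 x; have := h3 y; rewrite e; do !case: (_ \in _).
  - by have := h2 x; have := h1 y; rewrite e; do !case: (_ \in _).
  - by rewrite (i2 _ _ e).
  - by have := h2 x; have := h3 y; rewrite e; do !case: (_ \in _).
  - by have := h3 x; have := h1 y; rewrite e; do !case: (_ \in _).
  - by have := h3 x; have := h2 y; rewrite e; do !case: (_ \in _).
  - by rewrite (i3 _ _ e).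
exists f; last first.
  by congr (_, _, _); apply/ffunP => x; rewrite !ffunE.
rewrite inE; apply/and3P; split; first exact/injectiveP.
- rewrite eqEcard card_imset// card_tupleA cS leqnn andbT.
  apply/subsetP => _ /imsetP[[[]|] x xA ->]; rewrite ffunE ?inE in xA *.
  + by case/andP: (h1 x).
  + by case/andP: (h2 x).
  + by [].
- rewrite eqEcard card_imset// card_tupleB cS' leqnn andbT.
  apply/subsetP => _ /imsetP[[[]|] x xA ->]; rewrite ffunE ?inE in xA *.
  + by case/andP: (h1 x).
  + by [].
  + by case/andP: (h3 x).
Qed.

(** The injective tuples are grouped by their pair of images; each group has the size given by
    [card_injective_images]. *)
Lemma card_injective_tuples (T : finType) (Q : pred {set T}) (i p q : nat) :
  #|[set f : {ffun 'I_i + 'I_p + 'I_q -> T} |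
      [&& injectiveb f, Q (f @: tupleA i p q) & Q (f @: tupleB i p q)]]%SET| =
  (#|pairs_meeting Q i (i + p) (i + q)| * (i`! * p`! * q`!))%N.
Proof.
pose im (f : {ffun 'I_i + 'I_p + 'I_q -> T}) := (f @: tupleA i p q, f @: tupleB i p q).
rewrite -sum_nat_const -sum1_card.
rewrite (partition_big im (fun U => U \in pairs_meeting Q i (i + p) (i + q)))/=.
  apply: eq_bigr => -[S S']; rewrite /pairs_meeting inE/=.
  move=> /and5P[QS QS' /eqP cS /eqP cS' /eqP cI].
  rewrite -(card_injective_images cS cS' cI) -sum1_card; apply: eq_bigl => f.
  rewrite /= !inE; apply/idP/idP.
    by move=> /andP[/and3P[-> _ _] /eqP[-> ->]]; rewrite !eqxx.
  by move=> /and3P[-> /eqP fA /eqP fB]; rewrite /im fA fB QS QS' eqxx.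
move=> f; rewrite /pairs_meeting !inE => /and3P[/injectiveP fI -> ->] /=.
rewrite !card_imset// card_tupleA card_tupleB !eqxx/= -imsetI.
  by rewrite card_imset// card_tupleABI.
by move=> ? ? _ _; apply: fI.
Qed.

(** Goodness is tested coordinate by coordinate, and transposition turns a tuple of cells into [d]
    independent tuples of points on the circle. *)
Lemma card_good_tuples (d s m : nat) (J : finType) (A B : {set J}) :
  #|[set f : {ffun J -> {ffun 'I_d -> 'I_s.+1}} | good m (f @: A) && good m (f @: B)]%SET| =
  ((\sum_(f : {ffun J -> 'I_s.+1}) fits m (f @: A) * fits m (f @: B)) ^ d)%N.
Proof.
pose E := [set f : {ffun J -> 'I_s.+1} | fits m (f @: A) && fits m (f @: B)]%SET.
have -> : (\sum_(f : {ffun J -> 'I_s.+1}) fits m (f @: A) * fits m (f @: B) = #|E|)%N.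
  rewrite -sum1_card [RHS]big_mkcond; apply: eq_bigr => f _.
  by rewrite mulnb inE; case: (_ && _).
pose tr (f : {ffun J -> {ffun 'I_d -> 'I_s.+1}}) : {ffun 'I_d -> {ffun J -> 'I_s.+1}} :=
  [ffun j => [ffun x => f x j]].
have tr_inj : injective tr.
  move=> f g /ffunP e; apply/ffunP => x; apply/ffunP => j.
  by have /ffunP/(_ x) := e j; rewrite !ffunE.
have trE (f : {ffun J -> {ffun 'I_d -> 'I_s.+1}}) (C : {set J}) j :
    [set (c : {ffun 'I_d -> 'I_s.+1}) j | c in f @: C]%SET = tr f j @: C.
  by rewrite -imset_comp; apply: eq_imset => x /=; rewrite !ffunE.
rewrite -[X in (_ ^ X)%N](card_ord d) -card_ffun_on -(card_imset _ tr_inj).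
apply: eq_card => F; apply/imsetP/ffun_onP => [[f + ->] j|FE].
  rewrite !inE => /andP[/forallP/(_ j) fA /forallP/(_ j) fB].
  by move: fA fB; rewrite !trE => -> ->.
exists [ffun x => [ffun j => F j x]]; last first.
  by apply/ffunP => j; apply/ffunP => x; rewrite !ffunE.
have e j : tr [ffun x => [ffun j => F j x]] j = F j.
  by apply/ffunP => x; rewrite !ffunE.
by rewrite inE; apply/andP; split; apply/forallP => j; rewrite trE e;
  have := FE j; rewrite inE => /andP[].
Qed.

(** The excess is at most the number of all non-injective maps. *)
Lemma card_injective_bounds (J T : finType) (Q : pred {ffun J -> T}) :
  (#|[set f : {ffun J -> T} | injectiveb f && Q f]%SET| <=
   #|[set f : {ffun J -> T} | Q f]%SET| <=
   #|[set f : {ffun J -> T} | injectiveb f && Q f]%SET| +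
   (#|T| ^ #|J| - #|T| ^_ #|J|))%N.
Proof.
apply/andP; split.
  by apply/subset_leq_card/subsetP => f; rewrite !inE => /andP[].
have -> : (#|T| ^ #|J| - #|T| ^_ #|J| =
    #|~: [set f : {ffun J -> T} | injectiveb f]%SET|)%N.
  by rewrite [RHS]cardsCs setCK card_inj_ffuns card_ffun.
rewrite -[X in (X <= _)%N](cardsID [set f : {ffun J -> T} | injectiveb f]%SET).
apply: leq_add.
  by apply/subset_leq_card/subsetP => f; rewrite !inE andbC.
by apply/subset_leq_card/subsetP => f; rewrite !inE => /andP[].
Qed.

From mathcomp Require Import all_classical all_reals all_analysis.
From mathcomp Require Import measurable_realfun.

Import numFieldNormedType.Exports.

Local Open Scope classical_set_scope.
Local Open Scope ring_scope.

(** * Asymptotics *)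

Lemma cvg_exprn (R : realType) (u : nat -> R) (l : R) (n : nat) :
  u s @[s --> \oo] --> l -> u s ^+ n @[s --> \oo] --> l ^+ n.
Proof.
move=> ul; elim: n => [|n IH]; first by under eq_fun do rewrite expr0; exact: cvg_cst.
by under eq_fun do rewrite exprS; rewrite exprS; exact: cvgM.
Qed.

Lemma cvg_invn (R : realType) : (s.+1%:R : R)^-1 @[s --> \oo] --> (0 : R).
Proof. exact: cvg_harmonic. Qed.

(* The predecessor makes [width * (a / s.+1)] strictly less than [2 * eps], as
   needed for open balls. *)
Definition width (R : realType) (a eps : R) (s : nat) : nat :=
  (Num.trunc (2 * eps / (a / s.+1%:R))).-1.

Lemma width_lt (R : realType) (a eps : R) (s : nat) : 0 < a -> 0 < eps ->
  (width a eps s)%:R * (a / s.+1%:R) < 2 * eps.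
Proof.
move=> a0 e0; have d0 : 0 < a / s.+1%:R by rewrite divr_gt0.
have x0 : 0 < 2 * eps / (a / s.+1%:R) by rewrite divr_gt0// mulr_gt0.
rewrite -ltr_pdivlMr// /width; have /andP[+ _] := truncn_itv (ltW x0).
case: (Num.trunc _) => [//|n] /=; apply: lt_le_trans; by rewrite ltr_nat.
Qed.

(** One cell length is lost to the truncation and one to the predecessor. *)
Lemma width_ge (R : realType) (a eps : R) (s : nat) : 0 < a -> 0 < eps ->
  2 * eps - 2 * (a / s.+1%:R) <= (width a eps s)%:R * (a / s.+1%:R).
Proof.
move=> a0 e0; have d0 : 0 < a / s.+1%:R by rewrite divr_gt0.
have x0 : 0 < 2 * eps / (a / s.+1%:R) by rewrite divr_gt0// mulr_gt0.
rewrite -ler_pdivrMr// mulrBl mulfK ?gt_eqF// /width.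
have /andP[_ /ltW h] := truncn_itv (ltW x0).
rewrite lerBlDr (le_trans h)// -natrD ler_nat; lia.
Qed.

(** The bound [eps < a / 4] keeps the arcs within half of the circle, as the arc counts require. *)
Lemma width_double (R : realType) (a eps : R) (s : nat) : 0 < eps < a / 4 ->
  ((width a eps s).*2 <= s.+1)%N.
Proof.
move=> /andP[e0 ea]; have a0 : 0 < a by lra.
have := width_lt s a0 e0; rewrite mulrA ltr_pdivrMr ?ltr0n// => h.
rewrite -(ler_nat R) -muln2 natrM -(ler_pM2r a0).
have : eps * s.+1%:R <= a / 4 * s.+1%:R by rewrite ler_pM2r ?ltr0n// ltW.
by move: h; lra.
Qed.

Lemma cvg_width (R : realType) (a eps : R) : 0 < a -> 0 < eps ->
  (width a eps s)%:R / s.+1%:R @[s --> \oo] --> 2 * eps / a.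
Proof.
move=> a0 e0; have E (x M : R) : x * (a / M) / a = x / M.
  by rewrite mulrA mulrAC mulfK ?gt_eqF.
apply: (@squeeze_cvgr _ _ _ _ (fun s => 2 * eps / a - 2 * s.+1%:R^-1)
    (fun=> 2 * eps / a)); last exact: cvg_cst.
  apply: nearW => s; apply/andP; split.
    have := width_ge s a0 e0; rewrite -(ler_pM2r (x := a^-1)) ?invr_gt0//.
    have -> : (2 * eps - 2 * (a / s.+1%:R)) / a = 2 * eps / a - 2 * s.+1%:R^-1.
      have : s.+1%:R != 0 :> R by rewrite pnatr_eq0.
      by move: s.+1%:R => M M0; field; rewrite M0 gt_eqF.
    by rewrite E.
  have := ltW (width_lt s a0 e0); rewrite -(ler_pM2r (x := a^-1)) ?invr_gt0//.
  by rewrite E.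
rewrite -[X in _ --> X]subr0; apply: cvgB; first exact: cvg_cst.
rewrite -(mulr0 2); apply: cvgM; [exact: cvg_cst|exact: cvg_invn].
Qed.

(** As the two bases differ by one, [subrXX] leaves a sum of [n] products of [n.-1] factors, each
    factor tending to [theta] after scaling. *)
Lemma cvg_diff_pow (R : realType) (m : nat -> nat) (theta : R) (n : nat) :
  0 < theta -> (m s)%:R / s.+1%:R @[s --> \oo] --> theta ->
  ((m s)%:R ^+ n - (m s).-1%:R ^+ n) / s.+1%:R ^+ n * s.+1%:R @[s --> \oo] -->
  n%:R * theta ^+ n.-1.
Proof.
move=> th0 mth.
have m0 : \forall s \near \oo, (0 < m s)%N.
  apply: (filterS _ (cvgr_gt theta mth 0 th0)) => s /=.
  by case: (m s) => //; rewrite mul0r ltxx.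
have mth' : (m s).-1%:R / s.+1%:R @[s --> \oo] --> theta.
  have : (m s)%:R / s.+1%:R - s.+1%:R^-1 @[s --> \oo] --> theta - 0.
    by apply: cvgB => //; exact: cvg_invn.
  rewrite subr0; apply: cvg_trans; apply: near_eq_cvg; apply: filterS m0 => s ms.
  by rewrite -[in LHS](prednK ms) -natr1 mulrDl mul1r addrK.
pose S s : R := \sum_(i < n) ((m s)%:R / s.+1%:R) ^+ (n.-1 - i) * ((m s).-1%:R / s.+1%:R) ^+ i.
have : S s @[s --> \oo] --> n%:R * theta ^+ n.-1.
  have -> : n%:R * theta ^+ n.-1 = \sum_(i < n) theta ^+ (n.-1 - i) * theta ^+ i.
    rewrite (eq_bigr (fun=> theta ^+ n.-1)) => [|i _].
      by rewrite sumr_const card_ord mulr_natl.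
    by rewrite -exprD subnK//; have := ltn_ord i; lia.
  apply: cvg_big => // [|i _]; first exact: add_continuous.
  by apply: cvgM; apply: cvg_exprn.
apply: cvg_trans; apply: near_eq_cvg; apply: filterS m0 => s ms.
rewrite mulrBl -!expr_div_n subrXX -/(S s) -mulrBl -natrB ?leq_pred//.
have -> : (m s - (m s).-1 = 1)%N by lia.
by rewrite mulrAC mul1r mulVf ?pnatr_eq0// mul1r.
Qed.

(** A discrete form of integrating [t ^ i] from 0 to [m]: [m.+1 ^ i.+1 - m ^ i.+1] is a sum of
    [i.+1] terms between [m ^ i] and [m.+1 ^ i]. *)
Lemma sum_pow_bounds (m i : nat) :
  (i.+1 * (\sum_(t < m) t ^ i) <= m ^ i.+1 <= i.+1 * (\sum_(t < m) t ^ i + m ^ i))%N.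
Proof.
have mono e x : (x ^ e <= x.+1 ^ e)%N by case: e => // e; rewrite leq_exp2r.
elim: m => [|m /andP[IH1 IH2]].
  by rewrite big_ord0 muln0 exp0n.
have h : (i.+1 * m ^ i <= m.+1 ^ i.+1 - m ^ i.+1 <= i.+1 * m.+1 ^ i)%N.
  rewrite subn_exp subSnn mul1n -[X in (X * _)%N](card_ord i.+1) -sum_nat_const.
  rewrite -[X in (_ <= X * _)%N](card_ord i.+1) -sum_nat_const.
  apply/andP; split; apply: leq_sum => j _.
    have -> : (m ^ i = m ^ (i.+1.-1 - j) * m ^ j)%N.
      by rewrite -expnD subnK//=; have := ltn_ord j.
    by rewrite leq_mul// mono.
  have -> : (m.+1 ^ i = m.+1 ^ (i.+1.-1 - j) * m.+1 ^ j)%N.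
    by rewrite -expnD subnK//=; have := ltn_ord j.
  by rewrite leq_mul// mono.
have le : (m ^ i.+1 <= m.+1 ^ i.+1)%N by rewrite leq_exp2r.
rewrite big_ord_recr/=; move: h IH1 IH2 le.
rewrite !mulnDr; move: (i.+1 * m ^ i)%N (i.+1 * m.+1 ^ i)%N => x y.
move: (m ^ i.+1)%N (m.+1 ^ i.+1)%N (i.+1 * _)%N.
lia.
Qed.

Lemma cvg_sum_pow (R : realType) (m : nat -> nat) (theta : R) (i : nat) :
  (m s)%:R / s.+1%:R @[s --> \oo] --> theta ->
  (\sum_(t < m s) t ^ i)%N%:R / s.+1%:R ^+ i.+1 @[s --> \oo] --> theta ^+ i.+1 / i.+1%:R.
Proof.
move=> mth; pose u s : R := (m s)%:R / s.+1%:R.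
apply: (@squeeze_cvgr _ _ _ _ (fun s => u s ^+ i.+1 / i.+1%:R - u s ^+ i * s.+1%:R^-1)
    (fun s => u s ^+ i.+1 / i.+1%:R)).
- apply: nearW => s; have /andP[] := sum_pow_bounds (m s) i.
  rewrite -!(ler_nat R) !natrM natrD !natrX; set F : R := _%:R.
  have M0 : 0 < s.+1%:R :> R by rewrite ltr0n.
  have i0 : 0 < i.+1%:R :> R by rewrite ltr0n.
  rewrite /u !expr_div_n => h1 h2; apply/andP; split.
    have -> : (m s)%:R ^+ i / s.+1%:R ^+ i / s.+1%:R = (m s)%:R ^+ i / s.+1%:R ^+ i.+1 :> R.
      by rewrite [in RHS]exprSr invfM mulrA.
    rewrite lerBlDr -mulrDl mulrAC ler_pM2r ?invr_gt0 ?exprn_gt0//.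
    by rewrite ler_pdivrMr// mulrC.
  by rewrite [leRHS]mulrAC ler_pM2r ?invr_gt0 ?exprn_gt0// ler_pdivlMr// mulrC.
- rewrite -[X in _ --> X]subr0; apply: cvgB.
    by apply: cvgM; [exact: cvg_exprn|exact: cvg_cst].
  rewrite -(mulr0 (theta ^+ i)); apply: cvgM; [exact: cvg_exprn|exact: cvg_invn].
- by apply: cvgM; [exact: cvg_exprn|exact: cvg_cst].
Qed.

(** In the closed form of [sum_fits2], each difference of powers is of one order less than the power
    itself, while the sum of the [t ^ i] gains one order. Both terms therefore have order
    [s.+1 ^ (i + p + q)]. *)
Lemma cvg_sum_fits2 (R : realType) (m : nat -> nat) (theta : R) (J : finType)
    (A B : {set J}) (i p q : nat) :
  0 < theta -> (m s)%:R / s.+1%:R @[s --> \oo] --> theta ->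
  (forall s, ((m s).*2 <= s.+1)%N) -> (0 < i)%N ->
  (A :|: B = [set: J])%SET ->
  #|(A :&: B)%SET| = i -> #|(A :\: B)%SET| = p -> #|(B :\: A)%SET| = q ->
  (\sum_(f : {ffun J -> 'I_s.+1}) fits (m s) (f @: A) * fits (m s) (f @: B))%N%:R
    / s.+1%:R ^+ (i + p + q) @[s --> \oo] -->
  theta ^+ (i + p + q).-1 * ((i + p + q)%:R + 2 * (p * q)%:R / i.+1%:R).
Proof.
move=> th0 mth m2 i0 AB ci cp cq.
have AB0 : (A :&: B != finset.set0)%SET by rewrite -card_gt0 ci.
pose D n s : R := ((m s)%:R ^+ n - (m s).-1%:R ^+ n) / s.+1%:R ^+ n * s.+1%:R.
have cD n : D n s @[s --> \oo] --> n%:R * theta ^+ n.-1 by exact: cvg_diff_pow.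
have -> : theta ^+ (i + p + q).-1 * ((i + p + q)%:R + 2 * (p * q)%:R / i.+1%:R) =
    (i + p + q)%:R * theta ^+ (i + p + q).-1 +
    2 * (theta ^+ i.+1 / i.+1%:R) * (p%:R * theta ^+ p.-1) * (q%:R * theta ^+ q.-1).
  rewrite mulrDr [X in X + _]mulrC; congr (_ + _).
  (* For [p = 0] or [q = 0] the truncated exponents [p.-1] and [q.-1] do not add up, but the product
     vanishes. *)
  case: p {cp cD} => [|p]; first by rewrite mul0n !(mul0r, mulr0).
  case: q {cq} => [|q]; first by rewrite muln0 !(mul0r, mulr0).
  rewrite /= (_ : (i + p.+1 + q.+1).-1 = i.+1 + p + q)%N; last lia.
  by rewrite !exprD natrM; ring.
have /(cvgM (cvg_cst (2 : R))) := cvg_sum_pow (i := i) mth.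
move=> /cvgM/(_ (cD p))/cvgM/(_ (cD q))/(cvgD (cD (i + p + q)%N)) h.
apply: cvg_trans h; apply: near_eq_cvg; apply: nearW => s.
rewrite (sum_fits2 R AB AB0 (m2 s)) ci cp cq /D /=.
have : s.+1%:R != 0 :> R by rewrite pnatr_eq0.
rewrite fctE /= !exprD exprS; move: s.+1%:R => M M0.
by field; rewrite ?expf_neq0.
Qed.

(** * Occupation probability of a cell *)

(* The probability that a given cell contains a point of the process. *)
Definition occupancy (R : realType) (lambda a : R) (d s : nat) : R :=
  1 - expR (- (lambda * (a / s.+1%:R) ^+ d)).

Lemma occupancy_ge0 (R : realType) (lambda a : R) (d s : nat) :
  0 < lambda -> 0 < a -> 0 <= occupancy lambda a d s.
Proof.
move=> l0 a0; rewrite subr_ge0 -[leRHS]expR0 ler_expR oppr_le0.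
by rewrite mulr_ge0 ?(ltW l0)// exprn_ge0// divr_ge0// ltW.
Qed.

(** Both bounds are [1 + x <= expR x], at [x = mu] and at [x = - mu]. *)
Lemma occupancy_bounds (R : realType) (lambda a : R) (d s : nat) :
  0 < lambda -> 0 < a ->
  lambda * (a / s.+1%:R) ^+ d / (1 + lambda * (a / s.+1%:R) ^+ d) <=
  occupancy lambda a d s <= lambda * (a / s.+1%:R) ^+ d.
Proof.
move=> l0 a0; rewrite /occupancy; set mu := lambda * _.
have mu0 : 0 < mu by rewrite mulr_gt0// exprn_gt0// divr_gt0.
apply/andP; split; last by have := expR_ge1Dx (- mu); lra.
have -> : mu / (1 + mu) = 1 - (1 + mu)^-1 by field; rewrite gt_eqF// addr_gt0.
rewrite lerD2l lerN2 expRN lef_pV2 ?posrE ?expR_gt0 ?addr_gt0//.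
exact: expR_ge1Dx.
Qed.

Lemma cells_occupancy (R : realType) (lambda a : R) (d s : nat) :
  0 < a -> s.+1%:R ^+ d * (lambda * (a / s.+1%:R) ^+ d) = lambda * a ^+ d.
Proof.
move=> a0; rewrite expr_div_n mulrCA; congr (_ * _).
by rewrite mulrC mulfVK// expf_neq0// pnatr_eq0.
Qed.

Lemma cells_occupancy_le (R : realType) (lambda a : R) (d s : nat) :
  0 < lambda -> 0 < a ->
  s.+1%:R ^+ d * occupancy lambda a d s <= lambda * a ^+ d.
Proof.
move=> l0 a0; rewrite -(@cells_occupancy _ lambda a d s)//.
by rewrite ler_pM2l ?exprn_gt0//; have /andP[] := occupancy_bounds d s l0 a0.
Qed.

Lemma cvg_cell_mass (R : realType) (lambda a : R) (d : nat) : (0 < d)%N ->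
  lambda * (a / s.+1%:R) ^+ d @[s --> \oo] --> 0.
Proof.
move=> d0; rewrite -(mulr0 lambda); apply: cvgM; first exact: cvg_cst.
rewrite -[X in _ --> X](expr0n R d.-1.+1) prednK//; apply: cvg_exprn.
rewrite -(mulr0 a); apply: cvgM; [exact: cvg_cst|exact: cvg_invn].
Qed.

Lemma cvg_cells_occupancy (R : realType) (lambda a : R) (d : nat) :
  (0 < d)%N -> 0 < lambda -> 0 < a ->
  s.+1%:R ^+ d * occupancy lambda a d s @[s --> \oo] --> lambda * a ^+ d.
Proof.
move=> d0 l0 a0; pose mu s := lambda * (a / s.+1%:R) ^+ d.
apply: (@squeeze_cvgr _ _ _ _ (fun s => lambda * a ^+ d / (1 + mu s))
   (fun=> lambda * a ^+ d)); last exact: cvg_cst.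
  apply: nearW => s; rewrite cells_occupancy_le// andbT.
  rewrite -(@cells_occupancy _ lambda a d s)// -mulrA ler_pM2l ?exprn_gt0//.
  by have /andP[] := occupancy_bounds d s l0 a0.
rewrite -[X in _ --> X]divr1; apply: cvgM; first exact: cvg_cst.
apply: cvgV => //; rewrite -[X in _ --> X]addr0.
by apply: cvgD; [exact: cvg_cst|exact: cvg_cell_mass].
Qed.

Lemma cvg_occupancy (R : realType) (lambda a : R) (d : nat) :
  (0 < d)%N -> 0 < lambda -> 0 < a ->
  occupancy lambda a d s @[s --> \oo] --> 0.
Proof.
move=> d0 l0 a0; apply: (@squeeze_cvgr _ _ _ _ (fun=> 0)
  (fun s => lambda * (a / s.+1%:R) ^+ d)); [|exact: cvg_cst|exact: cvg_cell_mass].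
apply: nearW => s; rewrite occupancy_ge0//=.
by have /andP[] := occupancy_bounds d s l0 a0.
Qed.

Lemma ffact_le_expn (n m : nat) : (n ^_ m <= n ^ m)%N.
Proof.
rewrite ffact_prod -[X in (_ <= _ ^ X)%N](card_ord m) -prod_nat_const.
by apply: leq_prod => i _; exact: leq_subr.
Qed.

(** This is the proportion of injective [n]-tuples among all [n]-tuples of cells; non-injective ones
    are thus negligible. *)
Lemma cvg_ffact_ratio (R : realType) (d n : nat) : (0 < d)%N ->
  ((s.+1 ^ d) ^_ n)%:R / ((s.+1 ^ d) ^ n)%:R @[s --> \oo] --> (1 : R).
Proof.
move=> d0.
have E s : ((s.+1 ^ d) ^_ n)%:R / ((s.+1 ^ d) ^ n)%:R =
    \prod_(j < n) ((s.+1 ^ d - j)%N%:R / (s.+1 ^ d)%N%:R) :> R.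
  by rewrite ffact_prod natr_prod prodf_div prodr_const card_ord natrX.
under eq_fun do rewrite E.
suff : \prod_(j < n) ((s.+1 ^ d - j)%N%:R / (s.+1 ^ d)%N%:R) @[s --> \oo] -->
    \prod_(j < n) (1 : R) by rewrite [X in _ --> X]big1.
apply: cvg_big => // [|j _]; first exact: mul_continuous.
(* The lower bound uses [s.+1 <= s.+1 ^ d], which holds since [d] is positive. *)
apply: (@squeeze_cvgr _ _ _ _ (fun s => 1 - j%:R * s.+1%:R^-1) (fun=> 1)); last exact: cvg_cst.
  apply: nearW => s; have N0 : (0 < s.+1 ^ d)%N by rewrite expn_gt0.
  have N0' : 0 < (s.+1 ^ d)%N%:R :> R by rewrite ltr0n.
  apply/andP; split; last by rewrite ler_pdivrMr// mul1r ler_nat leq_subr.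
  apply: (@le_trans _ _ (1 - j%:R / (s.+1 ^ d)%N%:R)).
    rewrite lerD2l lerN2 ler_wpM2l// lef_pV2 ?posrE ?ltr0n// ler_nat.
    by rewrite -[leqLHS]expn1 leq_pexp2l.
  rewrite -{1}(divff (lt0r_neq0 N0')) -mulrBl ler_pM2r ?invr_gt0//.
  by rewrite lerBlDr -natrD ler_nat; lia.
rewrite -[X in _ --> X]subr0; apply: cvgB; first exact: cvg_cst.
rewrite -(mulr0 j%:R); apply: cvgM; [exact: cvg_cst|exact: cvg_invn].
Qed.

(** Up to non-injective tuples, the number of pairs times the factorials is the [d]-th power of the
    circle count. It is divided by the number [(s.+1 ^ d) ^ n] of all tuples, while
    [s.+1 ^ d * occupancy] tends to [lambda * a ^+ d]. *)
Lemma cvg_pairs_meeting (R : realType) (lambda a theta : R) (d i p q : nat) (m : nat -> nat) :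
  (0 < d)%N -> 0 < lambda -> 0 < a -> 0 < theta ->
  (m s)%:R / s.+1%:R @[s --> \oo] --> theta ->
  (forall s, ((m s).*2 <= s.+1)%N) -> (0 < i)%N ->
  occupancy lambda a d s ^+ (i + p + q) *
    #|pairs_meeting (@good d s (m s)) i (i + p) (i + q)|%:R @[s --> \oo] -->
  (lambda * a ^+ d) ^+ (i + p + q) *
    (theta ^+ (i + p + q).-1 * ((i + p + q)%:R + 2 * (p * q)%:R / i.+1%:R)) ^+ d
    / (i`! * p`! * q`!)%:R.
Proof.
move=> d0 l0 a0 th0 mth m2 i0; set n := (i + p + q)%N; set L := theta ^+ _ * _.
pose E s := (\sum_(f : {ffun 'I_i + 'I_p + 'I_q -> 'I_s.+1})
  fits (m s) (f @: tupleA i p q) * fits (m s) (f @: tupleB i p q))%N.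
pose C s := #|pairs_meeting (@good d s (m s)) i (i + p) (i + q)|.
have EL : (E s)%:R / s.+1%:R ^+ n @[s --> \oo] --> L.
  apply: cvg_sum_fits2 => //; [exact: tupleABU|exact: card_tupleABI|
    exact: card_tupleAB|exact: card_tupleBA].
have fact0 : (0 < i`! * p`! * q`!)%N by rewrite !muln_gt0 !fact_gt0.
have cardG s : #|{ffun 'I_d -> 'I_s.+1}| = (s.+1 ^ d)%N by rewrite card_ffun !card_ord.
have cardJ : #|{: 'I_i + 'I_p + 'I_q}| = n by rewrite !card_sum !card_ord.
have bounds s : (C s * (i`! * p`! * q`!) <= E s ^ d <=
    C s * (i`! * p`! * q`!) + ((s.+1 ^ d) ^ n - (s.+1 ^ d) ^_ n))%N.
  rewrite /C -card_injective_tuples -card_good_tuples -cardG -cardJ.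
  exact: (@card_injective_bounds _ _ (fun f => good (m s) (f @: tupleA i p q)
    && good (m s) (f @: tupleB i p q))).
have cvgC : (C s * (i`! * p`! * q`!))%N%:R / ((s.+1 ^ d) ^ n)%:R @[s --> \oo] --> L ^+ d.
  have ELd : (E s ^ d)%N%:R / ((s.+1 ^ d) ^ n)%:R @[s --> \oo] --> L ^+ d.
    have := cvg_exprn (n := d) EL; apply: cvg_trans; apply: near_eq_cvg; apply: nearW => s.
    by rewrite expr_div_n !natrX -!exprM mulnC.
  apply: (@squeeze_cvgr _ _ _ _ (fun s => (E s ^ d)%N%:R / ((s.+1 ^ d) ^ n)%:R -
    (1 - ((s.+1 ^ d) ^_ n)%:R / ((s.+1 ^ d) ^ n)%:R))
    (fun s => (E s ^ d)%N%:R / ((s.+1 ^ d) ^ n)%:R)); last exact: ELd; last first.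
    rewrite -[X in _ --> X]subr0; apply: cvgB => //; rewrite -(subrr 1).
    by apply: cvgB; [exact: cvg_cst|exact: cvg_ffact_ratio].
  apply: nearW => s; have N0 : (0 < (s.+1 ^ d) ^ n)%N by rewrite !expn_gt0.
  have N0' : 0 < ((s.+1 ^ d) ^ n)%N%:R :> R by rewrite ltr0n.
  have /andP[b1 b2] := bounds s; apply/andP; split.
    have frac (x y N : R) : N != 0 -> x / N - (1 - y / N) = (x - (N - y)) / N.
      by move=> ?; field.
    rewrite frac ?gt_eqF// ler_pM2r ?invr_gt0// -natrB ?ffact_le_expn//.
    by rewrite lerBlDr -natrD ler_nat.
  by rewrite ler_pM2r ?invr_gt0// ler_nat.
have /cvgM/(_ cvgC) := cvg_exprn (n := n) (cvg_cells_occupancy d0 l0 a0).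
move=> /cvgM/(_ (cvg_cst ((i`! * p`! * q`!)%:R^-1 : R))).
apply: cvg_trans; apply: near_eq_cvg; apply: nearW => s; rewrite /= -/(C s).
have N0 : s.+1%:R != 0 :> R by rewrite pnatr_eq0.
have F0 : (i`! * p`! * q`!)%:R != 0 :> R by rewrite pnatr_eq0 -lt0n.
rewrite natrM !natrX exprMn; move: (_%:R) N0 F0 (C s)%:R => M M0; move: (_%:R) => F F0 c.
by field; rewrite F0 !expf_neq0.
Qed.

(** * Cells and simplices *)

Definition cell_index (R : realType) (a : R) (s : nat) (u : R) : 'I_s.+1 :=
  inord (Num.trunc (u / (a / s.+1%:R))).

Lemma cell_indexP (R : realType) (a : R) (s : nat) (u : R) (c : 'I_s.+1) :
  0 < a ->
  c%:R * (a / s.+1%:R) <= u < c.+1%:R * (a / s.+1%:R) ->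
  cell_index a s u = c.
Proof.
move=> a0; have d0 : 0 < a / s.+1%:R by rewrite divr_gt0.
rewrite -ler_pdivlMr// -ltr_pdivrMr// => /truncn_def h.
by rewrite /cell_index h inord_val.
Qed.

Lemma cell_index_itv (R : realType) (a : R) (s : nat) (u : R) :
  0 < a -> 0 <= u < a ->
  (cell_index a s u)%:R * (a / s.+1%:R) <= u < (cell_index a s u).+1%:R * (a / s.+1%:R).
Proof.
move=> a0 /andP[u0 ua]; have d0 : 0 < a / s.+1%:R by rewrite divr_gt0.
have x0 : 0 <= u / (a / s.+1%:R) by rewrite divr_ge0// ltW.
have /andP[h1 h2] := truncn_itv x0.
have h3 : (Num.trunc (u / (a / s.+1%:R)) < s.+1)%N.
  rewrite -(ltr_nat R); apply: le_lt_trans h1 _.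
  by rewrite ltr_pdivrMr// mulrCA divff ?pnatr_eq0// mulr1.
by rewrite -ler_pdivlMr// -ltr_pdivrMr// /cell_index inordK// h1.
Qed.

(* The witness is the middle point of the arc, or its translate by [- a]. *)
Lemma arc_center (R : realType) (a eps : R) (s m : nat) (w : 'I_s.+1) :
  0 < a -> eps < a -> m%:R * (a / s.+1%:R) < 2 * eps ->
  exists2 y : R, 0 <= y < a & forall u, 0 <= u < a -> cell_index a s u \in arc w m ->
    exists z : int, `|u - y + a * z%:~R| < eps.
Proof.
move=> a0 ea; set h := a / s.+1%:R => me.
have h0 : 0 < h by rewrite divr_gt0.
have ah : a = s.+1%:R * h by rewrite /h mulrCA divff ?mulr1// pnatr_eq0.
pose y0 := w%:R * h + m%:R * h / 2.
have wlt : (w%:R + 1) * h <= a.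
  by rewrite ah ler_pM2r// natr1 ler_nat ltn_ord.
have w0 : 0 <= w%:R * h by rewrite mulr_ge0// ltW.
have m0 : 0 <= m%:R * h by rewrite mulr_ge0// ltW.
have key u : 0 <= u < a -> cell_index a s u \in arc w m ->
    exists z : int, `|u - y0 + a * z%:~R| < eps.
  move=> /(cell_index_itv s a0) /andP[]; rewrite -/h inE.
  set c := cell_index a s u => h1 h2 cw.
  have := ord_sub_eqmod c w; set t := val (c - w)%R in cw * => /eqP.
  rewrite (modn_small (ltn_ord c)) => /eqP ct.
  (* The number of full turns made when going [t] steps ahead from [w]; translating [u] by that many
     periods puts it in the unrolled arc. *)
  exists ((w + t) %/ s.+1)%N%:Z.
  have := divn_eq (w + t) s.+1; rewrite -ct; set n := ((w + t) %/ s.+1)%N => E.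
  have {}E : w%:R + t%:R = n%:R * s.+1%:R + c%:R :> R by rewrite -natrD E natrD natrM.
  have an : a * n%:R = (w%:R + t%:R - c%:R) * h.
    by rewrite ah mulrAC E; ring.
  have th : (t%:R + 1) * h <= m%:R * h by rewrite ler_pM2r// natr1 ler_nat.
  have t0 : 0 <= t%:R * h by rewrite mulr_ge0// ltW.
  rewrite -natr1 in h2.
  rewrite [_%:~R]/(n%:R) an /y0 ltr_norml; apply/andP; split; lra.
have [y0a|y0a] := ltP y0 a.
  by exists y0; [apply/andP; split => //; rewrite /y0; lra|].
exists (y0 - a); first by rewrite subr_ge0 y0a /=; rewrite /y0; lra.
move=> u ua uw; have [z zu] := key u ua uw; exists (z - 1).
by move: zu; rewrite intrB mulrBr mulr1; congr (`|_| < _); ring.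
Qed.

(** The arc starts at the cell of [y - rho] on the unrolled circle. It must cover an interval of
    length [2 * rho], and aligning its start with a cell costs at most one more cell length. *)
Lemma arc_cover (R : realType) (a rho y : R) (s m : nat) :
  0 < a -> 0 <= rho -> 2 * rho + a / s.+1%:R < m%:R * (a / s.+1%:R) -> (m <= s.+1)%N ->
  exists w : 'I_s.+1, forall u, 0 <= u < a ->
    (exists z : int, `|u - y + a * z%:~R| <= rho) -> cell_index a s u \in arc w m.
Proof.
move=> a0 r0; set h := a / s.+1%:R => mr ms.
have h0 : 0 < h by rewrite divr_gt0.
have ah : a = s.+1%:R * h by rewrite /h mulrCA divff ?mulr1// pnatr_eq0.
pose w0 : int := Num.floor ((y - rho) / h).
have /andP[] := floor_itv ((y - rho) / h); rewrite -/w0.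
rewrite ler_pdivlMr// ltr_pdivrMr// intrD mulr1z => w1 w2.
have M0 : (s.+1%:Z != 0) by [].
pose w : nat := `|(w0 %% s.+1%:Z)%Z|.
have wE : w%:Z = (w0 %% s.+1%:Z)%Z by rewrite /w gez0_abs// modz_ge0.
have ws : (w < s.+1)%N by rewrite -ltz_nat wE ltz_pmod.
have w0E := divz_eq w0 s.+1%:Z; rewrite -wE in w0E.
exists (Ordinal ws) => u u01 [z]; rewrite ler_norml => /andP[z1 z2].
have /andP[] := cell_index_itv s a0 u01; rewrite -/h; set c := cell_index a s u => c1 c2.
rewrite inE; set k := (w0 %/ s.+1%:Z)%Z in w0E.
(* The position, counted from [w0], of the unrolled cell containing [u + a * z]. *)
pose q : int := c%:Z + z * s.+1%:Z - w0.
have qR : q%:~R = c%:R + z%:~R * s.+1%:R - w0%:~R :> R by rewrite /q intrB intrD intrM.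
have az : a * z%:~R = z%:~R * s.+1%:R * h by rewrite ah; ring.
have q0 : 0 <= q.
  have : (-1)%:~R < q%:~R :> R.
    rewrite -(ltr_pM2r h0) qR mulrN1z; rewrite -natr1 in c2; lra.
  by rewrite ltr_int; case: (q).
have qm : q < m%:Z.
  rewrite -(ltr_int R) -(ltr_pM2r h0) qR -pmulrn; lra.
have qE : q = `|q|%N%:Z by rewrite gez0_abs.
rewrite (@val_sub_ord _ _ _ `|q|%N); first by rewrite -ltz_nat -qE.
  by apply: leq_trans ms; rewrite -ltz_nat -qE.
apply/eqP; rewrite -[_ == _ %[mod _]]/(_ == _) -eqz_nat -!modz_nat.
apply/eqP/eqP; rewrite eqz_mod_dvd PoszD -qE /q; apply/dvdzP; exists (k - z).
rewrite w0E /=; ring.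
Qed.

(** * Torus distance and cells of points *)

Lemma rV_norm_ltP (R : realType) (d : nat) (x : 'rV[R]_d) (r : R) :
  0 < r -> (forall j, `|x 0 j| < r) <-> `|x| < r.
Proof.
move=> r0; have -> : `|x| = \big[Num.max/0]_ij `|x ij.1 ij.2| by exact: mx_normrE.
split => [xr|/bigmax_ltP[_ xr] j].
  by apply: bigmax_lt => // -[i j] _ /=; rewrite ord1.
exact: (xr (0, j)).
Qed.

Lemma torus_dist_ltP (R : realType) (d : nat) (a : R) (x y : 'rV[R]_d) (r : R) :
  torus_dist a x y < r <->
  exists m : 'rV[int]_d, `|x - y + a *: map_mx intr m| < r.
Proof.
rewrite /torus_dist; split => [/inf_lt[]|[m mr]].
- by exists `|x - y + a *: map_mx intr 0|, 0.
- by move=> _ [m _ <-] mr; exists m.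
- apply: le_lt_trans mr; apply: ge_inf; last by exists m.
  by exists 0 => _ [n _ <-].
Qed.

Definition cell (R : realType) (d : nat) (a : R) (s : nat)
    (c : {ffun 'I_d -> 'I_s.+1}) : set 'rV[R]_d :=
  [set x | forall j, (c j)%:R * (a / s.+1%:R) <= x 0 j < (c j).+1%:R * (a / s.+1%:R)].

Definition cell_of (R : realType) (d : nat) (a : R) (s : nat) (x : 'rV[R]_d) :
    {ffun 'I_d -> 'I_s.+1} :=
  [ffun j => cell_index a s (x 0 j)].

Lemma cell_ofP (R : realType) (d : nat) (a : R) (s : nat) (x : 'rV[R]_d)
    (c : {ffun 'I_d -> 'I_s.+1}) :
  0 < a -> torus a x -> cell a c x <-> cell_of a s x = c.
Proof.
move=> a0 xa; split => [xc|<- j]; last by rewrite ffunE; exact: cell_index_itv.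
by apply/ffunP => j; rewrite ffunE; apply: cell_indexP (xc j).
Qed.

Lemma cell_torus (R : realType) (d : nat) (a : R) (s : nat)
    (c : {ffun 'I_d -> 'I_s.+1}) :
  0 < a -> (cell a c `<=` @torus R d a)%classic.
Proof.
move=> a0 x xc j; have /andP[h1 h2] := xc j.
have h0 : 0 <= a / s.+1%:R by rewrite divr_ge0// ltW.
apply/andP; split; first by apply: le_trans h1; rewrite mulr_ge0.
apply: (lt_le_trans h2).
by rewrite mulrA ler_pdivrMr// mulrC ler_pM2l// ler_nat.
Qed.

(** Balls of the sup norm are products of intervals, so a centre and the translates can be chosen in
    each coordinate by [arc_center]. *)
Lemma good_center (R : realType) (d : nat) (a eps : R) (s m : nat)
    (S : {set {ffun 'I_d -> 'I_s.+1}}) :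
  0 < eps < a -> m%:R * (a / s.+1%:R) < 2 * eps -> good m S ->
  exists2 y : 'rV[R]_d, torus a y & forall v, torus a v -> cell_of a s v \in S ->
    torus_dist a v y < eps.
Proof.
move=> /andP[e0 ea] me /forallP gS; have a0 : 0 < a by apply: lt_trans ea.
have /choice[y yP] : forall j : 'I_d, exists y : R, 0 <= y < a /\
    forall v : 'rV[R]_d, torus a v -> cell_of a s v \in S ->
    exists z : int, `|v 0 j - y + a * z%:~R| < eps.
  move=> j; have /existsP[w /fintype.subsetP wS] := gS j.
  have [y ya yP] := arc_center w a0 ea me; exists y; split => // v va vS.
  apply: yP; first exact: va.
  by apply: wS; apply/imsetP; exists (cell_of a s v) => //; rewrite ffunE.
exists (\row_j y j); first by move=> j; rewrite mxE; have [] := yP j.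
move=> v va vS; apply/torus_dist_ltP.
have /choice[z zP] := fun j => (yP j).2 v va vS.
exists (\row_j z j); apply/rV_norm_ltP => // j.
by rewrite !mxE.
Qed.

Lemma near_all_seq (T : eqType) (l : seq T) (Q : T -> nat -> Prop) :
  (forall x, x \in l -> \forall s \near \oo, Q x s) ->
  \forall s \near \oo, forall x, x \in l -> Q x s.
Proof.
elim: l => [|x l IH] H; first by apply: nearW => s x.
have h1 := H x (mem_head _ _).
have h2 : \forall s \near \oo, forall x, x \in l -> Q x s.
  by apply: IH => z zl; apply: H; rewrite inE zl orbT.
near=> s => z; rewrite inE => /predU1P[->|zl]; first by near: s.
by move: z zl; near: s.
Unshelve. all: by end_near.
Qed.

Lemma near_small_cell (R : realType) (a r : R) : 0 < r ->
  \forall s \near \oo, a / s.+1%:R < r.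
Proof.
move=> r0; have : a / s.+1%:R @[s --> \oo] --> a * 0.
  by apply: cvgM; [exact: cvg_cst|exact: cvg_invn].
by rewrite mulr0 => /cvgr_lt; apply.
Qed.

(** Finitely many strict inequalities leave a margin: all points are within some [rho < eps] of [y].
    Small cells then let [arc_cover] apply in every coordinate. *)
Lemma near_good (R : realType) (d : nat) (a eps : R) (l : seq 'rV[R]_d)
    (y : 'rV[R]_d) :
  0 < eps < a / 4 -> (forall v, v \in l -> torus a v) ->
  (forall v, v \in l -> torus_dist a v y < eps) ->
  \forall s \near \oo, good (width a eps s) [set c in map (cell_of a s) l]%SET.
Proof.
move=> eps4 la ly; have /andP[e0 ea] := eps4; have a0 : 0 < a by lra.
have [rho /andP[r0 re] rhoP] : exists2 rho : R, 0 <= rho < eps & forall v, v \in l ->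
    exists m : 'rV[int]_d, `|v - y + a *: map_mx intr m| <= rho.
  elim: l ly {la} => [|v l IH] ly; first by exists 0; rewrite ?lexx.
  have [|rho /andP[r0 re] rhoP] := IH.
    by move=> z zl; apply: ly; rewrite inE zl orbT.
  have /torus_dist_ltP[m mv] := ly v (mem_head _ _).
  exists (Num.max rho `|v - y + a *: map_mx intr m|).
    by rewrite le_max r0 gt_max re.
  move=> z; rewrite inE => /predU1P[->|/rhoP[n nz]].
    by exists m; rewrite le_max lexx orbT.
  by exists n; rewrite le_max nz.
(* The third of the slack, because two cell lengths are lost in [width_ge] and one in
   [arc_cover]. *)
have e3 : 0 < 2 * (eps - rho) / 3 by lra.
apply: filterS (near_small_cell a e3) => s /= sm.
apply/forallP => j.
have [||w wP] := @arc_cover R a rho (y 0 j) s (width a eps s) a0 r0.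
- have := width_ge s a0 e0; move: sm.
  by move: (a / s.+1%:R) => h; move: (width _ _ _)%:R => k ? ?; lra.
- by have := width_double s eps4; lia.
apply/existsP; exists w; apply/fintype.subsetP => _ /imsetP[c + ->].
rewrite inE => /mapP[v vl ->]; rewrite ffunE; apply: wP; first exact: la.
have [m mv] := rhoP v vl; exists (m 0 j).
apply: le_trans mv; rewrite [leRHS](mx_normrE _).
apply: le_trans (le_bigmax _ _ (0, j)).
by rewrite !mxE.
Qed.

(** Two distinct points differ in some coordinate, and are separated once the cells are shorter than
    that gap. *)
Lemma near_cell_of_inj (R : realType) (d : nat) (a : R) (l : seq 'rV[R]_d) :
  0 < a -> (forall v, v \in l -> torus a v) ->
  \forall s \near \oo, {in l &, injective (@cell_of R d a s)}.
Proof.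
move=> a0 la.
have : \forall s \near \oo, forall x, x \in l -> forall y, y \in l ->
    cell_of a s x = cell_of a s y -> x = y.
  apply: near_all_seq => x xl; apply: near_all_seq => y yl.
  have [->|/eqP xy] := pselect (x = y); first by apply: nearW.
  have [j xyj] : exists j, x 0 j != y 0 j.
    apply/existsP; apply: contraNT xy => /existsPn h; apply/eqP/rowP => j.
    by apply/eqP; have := h j; rewrite negbK.
  have e0 : 0 < `|x 0 j - y 0 j| by rewrite normr_gt0 subr_eq0.
  apply: filterS (near_small_cell a e0) => s /= sm /ffunP/(_ j); rewrite !ffunE => E.
  have /andP[x1 x2] := cell_index_itv s a0 (la x xl j).
  have /andP[y1 y2] := cell_index_itv s a0 (la y yl j).
  move: sm; rewrite E in x1 x2; rewrite -natr1 mulrDl mul1r in x2 y2.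
  rewrite ltNge => /negP[]; move: x1 x2 y1 y2; rewrite ler_norml.
  move: (a / s.+1%:R) (cell_index a s _)%:R => h c *; apply/andP; split; lra.
by apply: filterS => s h x y xl yl; apply: h.
Qed.

(** * Simplices against good sets of occupied cells *)

Lemma mem_cech_complex (R : realType) (d : nat) (a eps : R)
    (omega sigma : {fset 'rV[R]_d}) :
  sigma \in cech_complex a eps omega <->
  [/\ (sigma `<=` omega)%fset, sigma != fset0 &
    exists y, forall v, v \in sigma -> torus_ball a v eps y].
Proof.
rewrite !inE /= fpowersetE; split => [/and3P[so s0 /asboolP[y ys]]|[so s0 [y ys]]].
  by split=> //; exists y => v /ys.
by apply/and3P; split => //; apply/asboolP; exists y => v /ys.
Qed.

Lemma in_fset_sep (V : choiceType) (K : {fset V}) (Q : pred V) (x : V) :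
  (x \in [fset y in K | Q y]%fset) = (x \in K) && Q x.
Proof. by rewrite !inE. Qed.

(** Expressed by [count_in], to which the axioms of the point process apply directly. *)
Definition occupied (R : realType) (d : nat) (a : R) (s : nat)
    (omega : {fset 'rV[R]_d}) : {set {ffun 'I_d -> 'I_s.+1}} :=
  [set c | (0 < count_in (cell a c) omega)%N]%SET.

Definition occupied_good (R : realType) (d : nat) (a eps : R) (k s : nat)
    (omega : {fset 'rV[R]_d}) : {set {set {ffun 'I_d -> 'I_s.+1}}} :=
  [set S : {set {ffun 'I_d -> 'I_s.+1}} |
    [&& S \subset occupied a s omega, #|S| == k & good (width a eps s) S]]%SET.

Lemma mem_occupied (R : realType) (d : nat) (a : R) (s : nat)
    (omega : {fset 'rV[R]_d}) (c : {ffun 'I_d -> 'I_s.+1}) :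
  0 < a -> (forall x, x \in omega -> torus a x) ->
  c \in occupied a s omega <-> exists2 x, x \in omega & cell_of a s x = c.
Proof.
move=> a0 oa; rewrite inE /count_in cardfs_gt0; split.
  move=> /fset0Pn[x]; rewrite !inE /= => /andP[xo]; rewrite inE => xc.
  by exists x => //; apply/(cell_ofP _ a0) => //; exact: oa.
move=> [x xo xc]; apply/fset0Pn; exists x; rewrite !inE /= xo inE.
by apply/(cell_ofP _ a0) => //; exact: oa.
Qed.

(** One point of [omega] chosen in each cell of [S] gives a simplex by [good_center], and [S] is
    recovered as the set of cells of that simplex. *)
Lemma card_occupied_good_le (R : realType) (d : nat) (a eps : R) (k s : nat)
    (omega : {fset 'rV[R]_d}) :
  0 < eps < a / 4 -> (forall x, x \in omega -> torus a x) -> (0 < k)%N ->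
  (#|occupied_good a eps k s omega| <= num_simplices k.-1 (cech_complex a eps omega))%N.
Proof.
move=> eps4 oa k0; have /andP[e0 ea] := eps4; have a0 : 0 < a by lra.
rewrite /num_simplices prednK//; set K := [fset _ in _ | _]%fset.
pose cells (sigma : {fset 'rV[R]_d}) := [set c in map (cell_of a s) sigma]%SET.
apply: (@leq_trans #|[set S in map cells K]%SET|); last first.
  by rewrite cardsE (leq_trans (card_size _))// size_map.
apply/subset_leq_card/fintype.subsetP => S; rewrite inE.
move=> /and3P[/fintype.subsetP So /eqP Sk Sg].
pose rep c : 'rV[R]_d := nth 0 omega (find (fun x => cell_of a s x == c) omega).
have repP c : c \in S -> rep c \in omega /\ cell_of a s (rep c) = c.
  move=> /So /(mem_occupied _ a0 oa)[x xo xc].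
  have h : has (fun x => cell_of a s x == c) omega by apply/hasP; exists x => //; apply/eqP.
  by split; [apply: mem_nth; rewrite -has_find|apply/eqP/(nth_find 0 h)].
pose sigma : {fset 'rV[R]_d} := [fset x in [seq rep c | c <- enum S]]%fset.
have mem_sigma x : x \in sigma = (x \in [seq rep c | c <- enum S]) by rewrite !inE.
have rep_uniq : uniq [seq rep c | c <- enum S].
  rewrite map_inj_in_uniq ?enum_uniq// => c c'.
  by rewrite !mem_enum => /repP[_ rc] /repP[_ rc'] e; rewrite -rc e rc'.
have sigma_card : #|` sigma| = k.
  by rewrite /sigma card_fseq undup_id//= size_map -cardE Sk.
have sigma_omega x : x \in sigma -> x \in omega /\ cell_of a s x \in S.
  rewrite mem_sigma => /mapP[c]; rewrite mem_enum => cS ->.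
  by have [? ->] := repP c cS.
have cells_sigma : cells sigma = S.
  apply/setP => c; rewrite inE; apply/mapP/idP => [[x xs ->]|cS].
    by have [] := sigma_omega x xs.
  have [_ rc] := repP c cS; exists (rep c) => //.
  by rewrite mem_sigma; apply/mapP; exists c => //; rewrite mem_enum.
rewrite inE; apply/mapP; exists sigma => //.
have [||y ya yP] := @good_center R d a eps s (width a eps s) S _ _ Sg.
- by rewrite e0 /=; lra.
- exact: width_lt.
suff sK : sigma \in cech_complex a eps omega.
  by change (sigma \in K); rewrite in_fset_sep sK sigma_card eqxx.
apply/mem_cech_complex; split.
- by apply/fsubsetP => x /sigma_omega[].
- by rewrite -cardfs_gt0 sigma_card.
- exists y => v /sigma_omega[vo vS]; split => //; apply: yP => //; exact: oa.
Qed.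

(** For large [s] the points of [omega] lie in distinct cells and each of the finitely many
    simplices occupies a good set of cells. Hence [cells] injects simplices into good sets, which is
    the missing inequality. *)
Lemma near_card_occupied_good (R : realType) (d : nat) (a eps : R) (k : nat)
    (omega : {fset 'rV[R]_d}) :
  0 < eps < a / 4 -> (forall x, x \in omega -> torus a x) -> (0 < k)%N ->
  \forall s \near \oo,
    #|occupied_good a eps k s omega| = num_simplices k.-1 (cech_complex a eps omega).
Proof.
move=> eps4 oa k0; have /andP[e0 ea] := eps4; have a0 : 0 < a by lra.
pose K := [fset s in cech_complex a eps omega | #|` s| == k]%fset.
have ginj := @near_cell_of_inj R d a omega a0 oa.
have ggood : \forall s \near \oo, forall sigma, sigma \in enum_fset K ->
    good (width a eps s) [set c in map (cell_of a s) (enum_fset sigma)]%SET.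
  apply: near_all_seq => sigma; rewrite -[_ \in _]/(sigma \in K) in_fset_sep.
  move=> /andP[/mem_cech_complex[so _ [y yP]] _].
  apply: (@near_good _ _ _ _ _ y eps4) => v vs; first exact/oa/(fsubsetP so).
  by have [] := yP v vs.
near=> s.
have cinj : {in omega &, injective (@cell_of R d a s)} by near: s.
have cgood : forall sigma, sigma \in enum_fset K ->
    good (width a eps s) [set c in map (cell_of a s) (enum_fset sigma)]%SET by near: s.
apply/eqP; rewrite eqn_leq card_occupied_good_le//=.
rewrite /num_simplices prednK// -/K.
pose cells (sigma : {fset 'rV[R]_d}) := [set c in map (cell_of a s) sigma]%SET.
have Ksub sigma : sigma \in K -> {subset sigma <= omega} /\ #|` sigma| = k.
  rewrite in_fset_sep => /andP[/mem_cech_complex[/fsubsetP so _ _] /eqP ?].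
  by split.
have mem_cells sigma x : sigma \in K -> x \in omega ->
    (cell_of a s x \in cells sigma) = (x \in sigma).
  move=> /Ksub[so _] xo; rewrite inE; apply/mapP/idP => [[z zs zx]|xs]; last by exists x.
  by rewrite (cinj _ _ xo (so _ zs) zx).
have cells_inj : {in enum_fset K &, injective cells}.
  move=> sigma tau sK tK st; apply/fsetP => x.
  have [xo|xo] := boolP (x \in omega); first by rewrite -(mem_cells sigma)// -(mem_cells tau)// st.
  by apply/idP/idP => [/(Ksub _ sK).1|/(Ksub _ tK).1] xo'; rewrite xo' in xo.
have cells_uniq : uniq (map cells (enum_fset K)) by rewrite map_inj_in_uniq// fset_uniq.
rewrite -(size_map cells) -(card_uniqP cells_uniq).
apply/subset_leq_card/fintype.subsetP => _ /mapP[sigma sK ->].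
have [so sk] := Ksub sigma sK.
rewrite inE; apply/and3P; split.
- apply/fintype.subsetP => c; rewrite inE => /mapP[x xs ->].
  by apply/(mem_occupied _ a0 oa); exists x => //; exact: so.
- rewrite cardsE; apply/eqP; rewrite -[RHS]sk -(size_map (cell_of a s)).
  apply/card_uniqP; rewrite map_inj_in_uniq ?fset_uniq// => x y xs ys.
  by apply: cinj; exact: so.
- exact: cgood.
Unshelve. all: by end_near.
Qed.

(** * Covariance *)

Lemma borel_cell (R : realType) (d : nat) (a : R) (s : nat)
    (c : {ffun 'I_d -> 'I_s.+1}) : borel (cell a c).
Proof.
pose T := g_sigma_algebraType [set U : set 'rV[R]_d | open U].
have open_lt (j : 'I_d) (b : R) : (@measurable _ T) [set x : 'rV[R]_d | x 0 j < b].
  apply: sub_sigma_algebra => /=.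
  apply: (@open_comp _ _ (fun x : 'rV[R]_d => x 0 j) [set u | u < b]).
    by move=> x _; exact: coord_continuous.
  exact: open_lt.
have -> : cell a c = \bigcap_(j in [set: 'I_d])
    ([set x : 'rV[R]_d | x 0 j < (c j).+1%:R * (a / s.+1%:R)] `\`
     [set x : 'rV[R]_d | x 0 j < (c j)%:R * (a / s.+1%:R)]).
  apply/seteqP; split => x /= xc j.
    by move=> _; have /andP[h1 h2] := xc j; split => //=; apply/negP; rewrite -leNgt.
  by have [/= -> /negP] := xc j I; rewrite -leNgt => ->.
apply: (@fin_bigcap_measurable _ T) => // j _.
by apply: measurableD; exact: open_lt.
Qed.

Lemma lebesgue_rV_cell (R : realType) (d : nat) (a : R) (s : nat)
    (c : {ffun 'I_d -> 'I_s.+1}) :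
  0 < a -> lebesgue_rV (cell a c) = ((a / s.+1%:R) ^+ d)%:E.
Proof.
move=> a0; have h0 : 0 < a / s.+1%:R by rewrite divr_gt0.
pose l : 'rV[R]_d := \row_j ((c j)%:R * (a / s.+1%:R)).
pose u : 'rV[R]_d := \row_j ((c j).+1%:R * (a / s.+1%:R)).
have -> : cell a c = [set x | forall j, l 0 j <= x 0 j < u 0 j].
  by apply/seteqP; split => x /= xc j; have := xc j; rewrite !mxE.
rewrite lebesgue_rV_box => [|j]; last first.
  by rewrite !mxE ler_pM2r// ler_nat.
congr EFin; rewrite (eq_bigr (fun=> a / s.+1%:R)) => [|j _].
  by rewrite prodr_const card_ord.
by rewrite !mxE -mulrBl -natr1 addrAC subrr add0r mul1r.
Qed.

Lemma poisson_prob_gt0 (R : realType) (r : R) (k : nat) : 0 < r ->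
  poisson_prob r k [set n | (0 < n)%N] = (1 - expR (- r))%:E.
Proof.
move=> r0; have -> : [set n | (0 < n)%N] = ~` [set 0%N].
  by apply/seteqP; split => n /=; rewrite lt0n => /eqP.
transitivity (1 - poisson_prob r k [set 0%N])%E; first exact: probability_setC.
rewrite /poisson_prob r0 esum_set1 ?lee_fin ?poisson_pmf_ge0//.
by rewrite /poisson_pmf r0 expr0 mul1r fact0 invr1 mul1r EFinB.
Qed.

Lemma measurable_occupied (dO : measure_display)
    (Omega : measurableType dO) (R : realType) (P : probability Omega R)
    (d : nat) (a lambda : R) (omega : Omega -> {fset 'rV[R]_d}) (s : nat)
    (S : {set {ffun 'I_d -> 'I_s.+1}}) :
  0 < a -> poisson_point_process P a lambda omega ->
  measurable [set w | S \subset occupied a s (omega w)].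
Proof.
move=> a0 [_ mc _ _].
have -> : [set w | S \subset occupied a s (omega w)] =
    \bigcap_(c in [set` S])
      ((fun w => count_in (cell a c) (omega w)) @^-1` [set n | (0 < n)%N]).
  apply/seteqP; split => w /=.
    by move=> /fintype.subsetP Sw c /= /Sw; rewrite inE.
  by move=> Sw; apply/fintype.subsetP => c cS; rewrite inE; exact: Sw.
apply: fin_bigcap_measurable => // c _.
rewrite -[X in measurable X]setTI; apply: mc => //; first exact: borel_cell.
exact: cell_torus.
Qed.

Lemma prob_occupied (dO : measure_display)
    (Omega : measurableType dO) (R : realType) (P : probability Omega R)
    (d : nat) (a lambda : R) (omega : Omega -> {fset 'rV[R]_d}) (s : nat)
    (S : {set {ffun 'I_d -> 'I_s.+1}}) :
  0 < a -> 0 < lambda -> poisson_point_process P a lambda omega ->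
  P [set w | S \subset occupied a s (omega w)] = (occupancy lambda a d s ^+ #|S|)%:E.
Proof.
move=> a0 l0 [_ mc cP cI].
(* Independence is available for families indexed by ordinals, so all cells are enumerated and [S]
   selects a subfamily. *)
pose A (i : 'I_#|{ffun 'I_d -> 'I_s.+1}|) : set 'rV[R]_d := cell a (enum_val i).
have Acell i : borel (A i) /\ (A i `<=` torus a)%classic.
  by split; [exact: borel_cell|exact: cell_torus].
have Atriv : trivIset [set: _] A.
  apply/trivIsetP => i j _ _ ij; apply/seteqP; split => // x [xi xj].
  have xa := cell_torus a0 xi.
  have ci := (cell_ofP _ a0 xa).1 xi; have cj := (cell_ofP _ a0 xa).1 xj.
  by case/eqP: ij; apply: enum_val_inj; rewrite -ci -cj.
have := cI _ A Acell Atriv [set i | enum_val i \in S]%SET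
  (fun=> [set n | (0 < n)%N]) (fun=> I).
set E := (X in P X = _ -> _); have -> : [set w | S \subset occupied a s (omega w)] = E.
  apply/seteqP; split => w /=.
    by move=> /fintype.subsetP Sw i /=; rewrite inE => /Sw; rewrite inE.
  move=> Ew; apply/fintype.subsetP => c cS; rewrite inE.
  have := Ew (enum_rank c); rewrite /= inE enum_rankK => /(_ cS).
  by rewrite /A enum_rankK.
move=> ->.
rewrite (eq_bigr (fun=> (occupancy lambda a d s)%:E)) => [|i _]; last first.
  have -> := cP _ (Acell i).1 (Acell i).2 [set n | (0 < n)%N].
  rewrite lebesgue_rV_cell//= poisson_prob_gt0//.
  by rewrite mulr_gt0// exprn_gt0// divr_gt0.
have -> : #|S| = #|[set i : 'I_#|{ffun 'I_d -> 'I_s.+1}| | enum_val i \in S]%SET|.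
  rewrite -(card_imset _ (@enum_rank_inj _)); apply: eq_card => i.
  rewrite !inE; apply/imsetP/idP => [[c cS ->]|iS]; first by rewrite enum_rankK.
  by exists (enum_val i) => //; rewrite enum_valK.
by rewrite -prodr_const -prodEFin.
Qed.

(** * Expectations of counts and their limits *)

Lemma integral_sum_indic (dO : measure_display) (Omega : measurableType dO)
    (R : realType) (P : probability Omega R) (I : finType) (Q : pred I)
    (A : I -> set Omega) (r : I -> R) :
  (forall i, measurable (A i)) -> (forall i, P (A i) = (r i)%:E) ->
  (\int[P]_w (\sum_(i | Q i) \1_(A i) w)%:E)%E = (\sum_(i | Q i) r i)%:E.
Proof.
move=> mA PA; under eq_integral do rewrite -sumEFin -big_filter.
rewrite ge0_integral_sum//; last first.
  by move=> i; apply/measurable_EFinP/measurable_indic.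
rewrite -sumEFin -[RHS]big_filter; apply: eq_bigr => i _.
by rewrite integral_indic// setIT; exact: PA.
Qed.

Lemma measurable_sum_indic (dO : measure_display) (Omega : measurableType dO)
    (R : realType) (I : finType) (Q : pred I) (A : I -> set Omega) :
  (forall i, measurable (A i)) ->
  measurable_fun [set: Omega] (fun w => \sum_(i | Q i) \1_(A i) w : R).
Proof.
move=> mA; under eq_fun do rewrite -big_filter.
by apply: measurable_sum => i; exact: measurable_indic.
Qed.

(** Fatou's lemma and the uniform bound [K] make [Y] integrable; [Y] then dominates the [X s], and
    dominated convergence applies. *)
Lemma expectation_approximation (dO : measure_display) (Omega : measurableType dO)
    (R : realType) (P : probability Omega R) (X : nat -> Omega -> R) (Y : Omega -> R)
    (e : nat -> R) (K : R) :
  (forall s, measurable_fun [set: Omega] (X s)) ->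
  (forall s w, 0 <= X s w <= Y w) ->
  (forall w, \forall s \near \oo, X s w = Y w) ->
  (forall s, (\int[P]_w (X s w)%:E)%E = (e s)%:E) -> (forall s, e s <= K) ->
  Y \in Lfun P 1 /\ (e s)%:E @[s --> \oo] --> ('E_P[Y])%E.
Proof.
move=> mX XY nXY eX eK.
have cXY w : X s w @[s --> \oo] --> Y w.
  by apply: cvg_near_cst; exact: nXY.
have mY : measurable_fun [set: Omega] Y.
  by apply: (measurable_fun_cvg mX) => w _; exact: cXY.
have Y0 w : 0 <= Y w by have /andP[h1 h2] := XY 0%N w; apply: le_trans h2.
have intY : P.-integrable [set: Omega] (EFin \o Y).
  apply/integrableP; split; first exact/measurable_EFinP.
  under eq_integral do rewrite /= ger0_norm//.
  apply: (@le_lt_trans _ _ K%:E); last exact: ltry.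
  have mX' s : measurable_fun [set: Omega] (fun w => (X s w)%:E).
    exact/measurable_EFinP.
  have X0 s w : [set: Omega] w -> (0 <= (X s w)%:E)%E.
    by move=> _; rewrite lee_fin; have /andP[] := XY s w.
  have := fatou P measurableT mX' X0.
  have limY w : limn_einf (fun s => (X s w)%:E) = (Y w)%:E.
    have h : (X s w)%:E @[s --> \oo] --> (Y w)%:E.
      by apply: cvg_EFin; [exact: nearW|exact: cXY].
    by have [] := cvg_limn_einf_sup h.
  under eq_integral do rewrite limY.
  move=> /le_trans; apply.
  under eq_fun do rewrite eX.
  rewrite limn_einf_lim; apply: lime_le.
    exact: is_cvg_einfs.
  apply: nearW => n; apply: (@le_trans _ _ (e n)%:E); last by rewrite lee_fin.
  by apply: ereal_inf_lbound; exists n => /=.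
split; first exact/Lfun1_integrable.
rewrite unlock.
have := @dominated_cvg _ _ _ P _ measurableT (fun s w => (X s w)%:E) (EFin \o Y) (EFin \o Y).
under [X in _ -> _ -> _ -> _ -> _ -> X]eq_cvg do rewrite eX.
apply => //.
- by move=> s; exact/measurable_EFinP.
- by move=> w _; apply: cvg_EFin; [exact: nearW|exact: cXY].
- move=> s w _; have /andP[h1 h2] := XY s w.
  by rewrite /= lee_fin ger0_norm.
Qed.

Lemma card_occupied_good (R : realType) (d : nat) (a eps : R)
    (Omega : Type) (omega : Omega -> {fset 'rV[R]_d}) (k s : nat) (w : Omega) :
  #|occupied_good a eps k s (omega w)|%:R =
  \sum_(S : {set {ffun 'I_d -> 'I_s.+1}} | (#|S| == k) && good (width a eps s) S)
    \1_[set w | S \subset occupied a s (omega w)] w :> R.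
Proof.
rewrite -sum1_card natr_sum big_mkcond [RHS]big_mkcond; apply: eq_bigr => S _.
rewrite inE andbC; case: ((#|S| == k) && good _ S) => //=; rewrite indicE.
have [Sw|/negP Sw] := boolP (S \subset occupied a s (omega w)); first by rewrite mem_set.
by rewrite memNset.
Qed.

Lemma card_occupied_goodM (R : realType) (d : nat) (a eps : R)
    (Omega : Type) (omega : Omega -> {fset 'rV[R]_d}) (k l s : nat) (w : Omega) :
  #|occupied_good a eps k s (omega w)|%:R * #|occupied_good a eps l s (omega w)|%:R =
  \sum_(U : {set {ffun 'I_d -> 'I_s.+1}} * {set {ffun 'I_d -> 'I_s.+1}} |
      ((#|U.1| == k) && good (width a eps s) U.1) &&
      ((#|U.2| == l) && good (width a eps s) U.2))
    \1_[set w | (U.1 :|: U.2)%SET \subset occupied a s (omega w)] w :> R.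
Proof.
rewrite !card_occupied_good big_distrlr pair_big/=; apply: eq_bigr => -[S T] _ /=.
rewrite -[LHS]/((\1_ _ \* \1_ _) w) -indicI; congr (\1_ _ w).
by apply/seteqP; split => v /=; rewrite finset.subUset => /andP.
Qed.

(** The expectation of [#|occupied_good a eps k s omega|], by [prob_occupied]; [mean_good2] is
    likewise the mixed second moment. *)
Definition mean_good (R : realType) (d : nat) (lambda a eps : R) (k s : nat) : R :=
  \sum_(S : {set {ffun 'I_d -> 'I_s.+1}} | (#|S| == k) && good (width a eps s) S)
    occupancy lambda a d s ^+ #|S|.

Definition mean_good2 (R : realType) (d : nat) (lambda a eps : R) (k l s : nat) : R :=
  \sum_(U : {set {ffun 'I_d -> 'I_s.+1}} * {set {ffun 'I_d -> 'I_s.+1}} |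
      ((#|U.1| == k) && good (width a eps s) U.1) &&
      ((#|U.2| == l) && good (width a eps s) U.2))
    occupancy lambda a d s ^+ #|(U.1 :|: U.2)%SET|.

(** There are at most [(s.+1 ^ d) ^ k] sets of [k] cells, and [cells_occupancy_le] bounds the
    product uniformly in [s]. *)
Lemma mean_good_le (R : realType) (d : nat) (lambda a eps : R) (k s : nat) :
  0 < a -> 0 < lambda -> mean_good d lambda a eps k s <= (lambda * a ^+ d) ^+ k.
Proof.
move=> a0 l0; have p0 := occupancy_ge0 d s l0 a0.
apply: (@le_trans _ _ ((s.+1%:R ^+ d * occupancy lambda a d s) ^+ k)); last first.
  rewrite lerXn2r ?nnegrE ?cells_occupancy_le ?mulr_ge0 ?exprn_ge0 ?(ltW l0) ?(ltW a0)//.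
rewrite /mean_good big_mkcondr/=.
apply: (@le_trans _ _ (\sum_(S : {set {ffun 'I_d -> 'I_s.+1}} | #|S| == k)
    occupancy lambda a d s ^+ k)).
  by apply: ler_sum => S /eqP ->; case: ifP => // _; rewrite exprn_ge0.
rewrite sumr_const exprMn -[X in X <= _]mulr_natl ler_wpM2r ?exprn_ge0//.
rewrite -!natrX ler_nat -cardsE card_draws card_ffun !card_ord.
apply: leq_trans (ffact_le_expn _ _).
by rewrite -bin_ffact leq_pmulr// fact_gt0.
Qed.

(** A pair sharing [i] cells has a union of [k + l - i] cells and contributes
    [p ^+ (k + l - i) - p ^+ (k + l)]. Disjoint pairs contribute nothing. *)
Lemma mean_good_covariance (R : realType) (d : nat) (lambda a eps : R) (k l s : nat) :
  (l <= k)%N ->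
  mean_good2 d lambda a eps k l s -
    mean_good d lambda a eps k s * mean_good d lambda a eps l s =
  \sum_(i < l) (occupancy lambda a d s ^+ (k + l - i.+1) *
    #|pairs_meeting (@good d s (width a eps s)) i.+1 k l|%:R) *
    (1 - occupancy lambda a d s ^+ i.+1).
Proof.
move=> lk; set p := occupancy lambda a d s.
rewrite /mean_good2 /mean_good big_distrlr pair_big/= -sumrB.
(* The use of [inord] loses nothing, the intersection having at most [#|U.2| = l] cells. *)
rewrite (partition_big (fun U => inord #|(U.1 :&: U.2)%SET| : 'I_l.+1) xpredT)//=.
have termE (i : 'I_l.+1) :
    \sum_(U : {set {ffun 'I_d -> 'I_s.+1}} * {set {ffun 'I_d -> 'I_s.+1}} |
      ((#|U.1| == k) && good (width a eps s) U.1) &&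
      ((#|U.2| == l) && good (width a eps s) U.2) &&
      (inord #|(U.1 :&: U.2)%SET| == i))
    (p ^+ #|(U.1 :|: U.2)%SET| - p ^+ #|U.1| * p ^+ #|U.2|) =
    (p ^+ (k + l - i) * #|pairs_meeting (@good d s (width a eps s)) i k l|%:R) * (1 - p ^+ i).
  rewrite (eq_bigl (fun U => U \in pairs_meeting (@good d s (width a eps s)) i k l));
    last first => [U|].
    rewrite /pairs_meeting [RHS]inE; case: U => S T /=.
    have [/eqP Sk|] := boolP (#|S| == k); last by rewrite !andbF.
    have [/eqP Tl|] := boolP (#|T| == l); last by rewrite !andbF.
    case: (good _ S) => //=; case: (good _ T) => //=.
    rewrite -val_eqE/= inordK// ltnS -Tl.
    by apply/subset_leq_card/subsetIr.
  rewrite (eq_bigr (fun=> p ^+ (k + l - i) * (1 - p ^+ i))) => [|[S T]].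
    by rewrite sumr_const -mulr_natl; ring.
  rewrite /pairs_meeting inE /= => /and5P[_ _ /eqP Sk /eqP Tl /eqP ci]; rewrite Sk Tl.
  rewrite mulrBr mulr1 -!exprD; congr (p ^+ _ - p ^+ _); last by have := ltn_ord i; lia.
  by have := cardsUI S T; rewrite ci Sk Tl => <-; rewrite addnK.
rewrite (eq_bigr _ (fun i _ => termE i)) big_ord_recl /= expr0 subrr mulr0 add0r.
by apply: eq_bigr => i _.
Qed.

(** Termwise limit by [cvg_pairs_meeting] at [theta = 2 * eps / a]; the factor [1 - p ^+ i] tends to
    1, and the powers of [a] in [theta] turn [lambda * a ^+ d] into [lambda * (2 * eps) ^+ d] in all
    factors but one. *)
Lemma cvg_mean_covariance (R : realType) (d : nat) (lambda a eps : R) (k l : nat) :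
  (0 < d)%N -> 0 < a -> 0 < lambda -> 0 < eps < a / 4 -> (l <= k)%N ->
  mean_good2 d lambda a eps k l s -
    mean_good d lambda a eps k s * mean_good d lambda a eps l s
    @[s --> \oo] -->
  \sum_(1 <= i < l.+1)
     lambda * a ^+ d * (lambda * (2 * eps) ^+ d) ^+ (k + l - i - 1)
       / (i`! * (k - i)`! * (l - i)`!)%:R
     * ((k + l - i)%:R + 2 * ((k - i) * (l - i))%:R / i.+1%:R) ^+ d.
Proof.
move=> d0 a0 l0 eps4 lk; have /andP[e0 _] := eps4.
under eq_fun do rewrite mean_good_covariance//.
rewrite big_add1 /= big_mkord.
apply: cvg_big => [|i _]; first exact: add_continuous.
have il := ltn_ord i.
rewrite -[X in _ --> X]mulr1; apply: cvgM; last first.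
  rewrite -[X in _ --> X]subr0; apply: cvgB; first exact: cvg_cst.
  have := cvg_exprn (n := i.+1) (cvg_occupancy d0 l0 a0).
  by rewrite expr0n.
have th0 : 0 < 2 * eps / a by rewrite divr_gt0// mulr_gt0.
have := @cvg_pairs_meeting R lambda a (2 * eps / a) d i.+1 (k - i.+1) (l - i.+1)
  (width a eps) d0 l0 a0 th0 (cvg_width a0 e0) (fun s => width_double s eps4) isT.
have -> : (i.+1 + (k - i.+1) + (l - i.+1) = k + l - i.+1)%N by lia.
have -> : (i.+1 + (k - i.+1) = k)%N by lia.
have -> : (i.+1 + (l - i.+1) = l)%N by lia.
have [n En] : exists n, (k + l - i.+1 = n.+1)%N by exists (k + l - i.+1).-1; lia.
rewrite En subn1 /=; set L := (n.+1%:R + _ / _); set F := ((i.+1)`! * _ * _)%:R.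
have -> // : (lambda * a ^+ d) ^+ n.+1 * ((2 * eps / a) ^+ n * L) ^+ d / F =
  lambda * a ^+ d * (lambda * (2 * eps) ^+ d) ^+ n / F * L ^+ d.
have -> : (lambda * (2 * eps) ^+ d) ^+ n = (lambda * a ^+ d) ^+ n * ((2 * eps / a) ^+ n) ^+ d.
  rewrite [X in _ = _ * X]exprAC -exprMn expr_div_n -mulrA [a ^+ d * _]mulrC.
  by rewrite mulfVK// expf_neq0// gt_eqF.
rewrite [(_ * L) ^+ d]exprMn exprS.
move: ((lambda * a ^+ d) ^+ n) (lambda * a ^+ d) => x y.
move: (((2 * eps / a) ^+ n) ^+ d) (L ^+ d) => z t.
ring.
Qed.

Theorem theorem15 (R : realType) (d : nat) (a lambda eps : R)
    (dO : measure_display) (Omega : measurableType dO)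
    (P : probability Omega R) (omega : Omega -> {fset 'rV[R]_d}) (k l : nat) :
  (1 <= d)%N -> 0 < a -> 0 < lambda -> 0 < eps < a / 4 ->
  poisson_point_process P a lambda omega ->
  (1 <= l <= k)%N ->
  let N (j : nat) : Omega -> R :=
    fun w => (num_simplices j.-1 (cech_complex a eps (omega w)))%:R in
  covariance P (N k) (N l) =
  (\sum_(1 <= i < l.+1)
     lambda * a ^+ d * (lambda * (2 * eps) ^+ d) ^+ (k + l - i - 1)
       / (i`! * (k - i)`! * (l - i)`!)%:R
     * ((k + l - i)%:R + 2 * ((k - i) * (l - i))%:R / i.+1%:R) ^+ d)%:E.
Proof.
move=> d0 a0 l0 eps4 ppp /andP[l1 lk] N.
have oa w x : x \in omega w -> torus a x by case: ppp => + _ _ _; exact.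
pose X j s w : R := #|occupied_good a eps j s (omega w)|%:R.
pose e j s := mean_good d lambda a eps j s.
have mX j s : measurable_fun [set: Omega] (X j s).
  rewrite /X; under eq_fun do rewrite card_occupied_good.
  by apply: measurable_sum_indic => S; exact: measurable_occupied ppp.
have XN j s w : (0 < j)%N -> 0 <= X j s w <= N j w.
  by move=> j0; rewrite ler0n ler_nat/=; apply: card_occupied_good_le => // x; exact: oa.
have nXN j w : (0 < j)%N -> \forall s \near \oo, X j s w = N j w.
  move=> j0; apply: filterS (near_card_occupied_good eps4 (oa w) j0) => s h.
  by rewrite /X h.
have eX j s : (\int[P]_w (X j s w)%:E)%E = (e j s)%:E.
  rewrite /e /mean_good; under eq_integral do rewrite /X card_occupied_good.
  apply: (@integral_sum_indic _ _ _ P {set {ffun 'I_d -> 'I_s.+1}} _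
    (fun S => [set w | S \subset occupied a s (omega w)])
    (fun S => occupancy lambda a d s ^+ #|S|)) => S.
    exact: measurable_occupied ppp.
  exact: prob_occupied ppp.
have eXX s : (\int[P]_w (X k s w * X l s w)%:E)%E = (mean_good2 d lambda a eps k l s)%:E.
  rewrite /mean_good2; under eq_integral do rewrite /X card_occupied_goodM.
  apply: (@integral_sum_indic _ _ _ P
    ({set {ffun 'I_d -> 'I_s.+1}} * {set {ffun 'I_d -> 'I_s.+1}})%type _
    (fun U => [set w | (U.1 :|: U.2)%SET \subset occupied a s (omega w)])
    (fun U => occupancy lambda a d s ^+ #|(U.1 :|: U.2)%SET|)) => U.
    exact: measurable_occupied ppp.
  exact: prob_occupied ppp.
have approx j : (0 < j)%N -> N j \in Lfun P 1 /\ (e j s)%:E @[s --> \oo] --> ('E_P[N j])%E.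
  move=> j0.
  apply: (@expectation_approximation _ _ _ _ (X j) _ _ ((lambda * a ^+ d) ^+ j)) => //.
  - by move=> s w; exact: XN.
  - by move=> w; exact: nXN.
  - by move=> s; exact: mean_good_le.
have k0 : (0 < k)%N by exact: leq_trans lk.
have [LNk cNk] := approx k k0; have [LNl cNl] := approx l l1.
have cov := @cvg_mean_covariance R d lambda a eps k l d0 a0 l0 eps4 lk.
(* The discrete covariances converge, so they are bounded; adding the bound on the product of the
   means bounds the mixed moments uniformly in [s]. *)
have [B BP] : exists B, forall s, mean_good2 d lambda a eps k l s - e k s * e l s <= B.
  have /cvg_seq_bounded : cvgn (fun s => mean_good2 d lambda a eps k l s - e k s * e l s).
    by apply: cvgP cov.
  move=> /pinfty_ex_gt0[B B0 HB]; exists B => s.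
  by apply: le_trans (HB s I); exact: ler_norm.
have e_ge0 j s : 0 <= e j s.
  by apply: sumr_ge0 => S _; rewrite exprn_ge0// occupancy_ge0.
have [LNN cNN] : (N k * N l)%R \in Lfun P 1 /\
    (mean_good2 d lambda a eps k l s)%:E @[s --> \oo] --> ('E_P[N k * N l])%E.
  apply: (@expectation_approximation _ _ _ _ (fun s w => X k s w * X l s w) _ _
    (B + (lambda * a ^+ d) ^+ k * (lambda * a ^+ d) ^+ l)) => //.
  - by move=> s; exact: measurable_funM.
  - move=> s w; have /andP[x0 xN] := XN k s w k0; have /andP[y0 yN] := XN l s w l1.
    by rewrite mulr_ge0//= ler_pM.
  - move=> w; near=> s; have -> : X k s w = N k w by near: s; exact: nXN.
    by have -> : X l s w = N l w by near: s; exact: nXN.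
  - move=> s; rewrite -lerBlDr; apply: le_trans (BP s).
    by rewrite lerD2l lerN2 ler_pM// mean_good_le.
have real_cvg (u : nat -> R) (Y : Omega -> R) : Y \in Lfun P 1 ->
    (u s)%:E @[s --> \oo] --> ('E_P[Y])%E -> u s @[s --> \oo] --> fine ('E_P[Y])%E.
  by move=> LY; rewrite -[X in _ --> X -> _](fineK (expectation_fin_num LY)) => /fine_cvg.
have {}cNk := real_cvg _ _ LNk cNk; have {}cNl := real_cvg _ _ LNl cNl.
have {}cNN := real_cvg _ _ LNN cNN.
rewrite covarianceE//.
rewrite -(fineK (expectation_fin_num LNN)) -(fineK (expectation_fin_num LNk)).
rewrite -(fineK (expectation_fin_num LNl)) -EFinM -EFinB; congr EFin.
(* The discrete covariances have the closed form as a limit by [cov], and the covariance of [N k]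
   and [N l] by convergence of the three moments. *)
apply: (cvg_unique _ _ cov) => //.
by apply: cvgB => //; exact: cvgM.
Unshelve. all: by end_near.
Qed.
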